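(* Let $\partial$ and $\theta$ be regular cardinals with $\partial > \theta^+ > \theta \ge \aleph_0$, and let $\lambda = \partial^+$. Then $\Pr_1(\lambda,\lambda,\lambda,\theta)$ holds.
   Context: For cardinals $\lambda \ge \mu \ge \sigma + \theta_0 + \theta_1$ and $\bar\theta = (\theta_0,\theta_1)$, $\Pr_1(\lambda,\mu,\sigma,\bar\theta)$ means: there is a function $\mathbf c : [\lambda]^2 \to \sigma$ such that whenever $\mathbf i_0 < \theta_0$ and $\mathbf i_1 < \theta_1$ are ordinals, for $\iota = 0,1$ the sequence $\langle \zeta^\iota_{\alpha,i} : \alpha < \mu, i < \mathbf i_\iota\rangle$ is a sequence without repetitions of ordinals $< \lambda$, the ranges of these two sequences are disjoint, and $\gamma < \sigma$, then there are $\alpha_0 < \alpha_1 < \mu$ such that $\mathbf c\{\zeta^0_{\alpha_0,i_0},\zeta^1_{\alpha_1,i_1}\} = \gamma$ for all $i_0 < \mathbf i_0$, $i_1 < \mathbf i_1$. $\Pr_1(\lambda,\mu,\sigma,\theta)$ means $\Pr_1(\lambda,\mu,\sigma,(\theta,\theta))$. *)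

(* Defs.v *)
From mathcomp Require Import all_boot.
From mathcomp Require Import boolp wochoice classical_sets functions cardinality.

Set Implicit Arguments.
Unset Strict Implicit.
Unset Printing Implicit Defensive.

Local Open Scope classical_set_scope.
Local Open Scope card_scope.

(* A cardinal is an initial ordinal: a well-ordered type none of whose proper
   initial segments has the cardinality of the whole.  The elements of (the
   carrier of) kappa are the ordinals < kappa. *)
Record cardinal := Cardinal {
  ord_lt_card :> Type;
  cle : rel ord_lt_card;
  cle_wo : well_order cle;
  cardinal_initial : forall x : ord_lt_card,
    ~ ([set: ord_lt_card] #<= [set y | ~~ cle x y])
}.

(* The order is total, so x < y is the negation of y <= x. *)
Definition clt (k : cardinal) (x y : k) : bool := ~~ cle y x.

(* The ordinal x < k as the set of its predecessors. *)
Definition below (k : cardinal) (x : k) : Type := {y : k | clt y x}.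

Definition card_leq (k l : cardinal) : Prop := [set: k] #<= [set: l].

Definition card_lt (k l : cardinal) : Prop := card_leq k l /\ ~ card_leq l k.

Definition cofinal (k : cardinal) (X : set k) : Prop :=
  forall x : k, exists2 y, X y & cle x y.

(* k is infinite and cf(k) = k. *)
Definition regular (k : cardinal) : Prop :=
  infinite_set [set: k] /\ forall X : set k, cofinal X -> [set: k] #<= X.

(* l = k^+, the least cardinal greater than k. *)
Definition is_succ (k l : cardinal) : Prop :=
  card_lt k l /\ forall m : cardinal, card_lt k m -> card_leq l m.

(* [T]^2, the set of two-element subsets of T. *)
Definition pairs (T : Type) : Type :=
  {A : set T | exists x y : T, x <> y /\ A = [set x; y]}.

Definition upair (T : Type) (x y : T) (xy : x <> y) : pairs T :=
  exist _ [set x; y] (ex_intro _ x (ex_intro _ y (conj xy erefl))).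

(* The first two conjuncts are the standing requirement
   lambda >= mu >= sigma + theta0 + theta1. *)
Definition Pr1 (lambda mu sigma theta0 theta1 : cardinal) : Prop :=
  [/\ card_leq mu lambda,
      [set: sigma + theta0 + theta1] #<= [set: mu] &
      exists c : pairs lambda -> sigma,
      forall (i0 : theta0) (i1 : theta1)
             (zeta0 : mu -> below i0 -> lambda)
             (zeta1 : mu -> below i1 -> lambda),
        injective (fun p : mu * below i0 => zeta0 p.1 p.2) ->
        injective (fun p : mu * below i1 => zeta1 p.1 p.2) ->
        forall disj : (forall a i b j, zeta0 a i <> zeta1 b j),
        forall gamma : sigma,
        exists a0 a1 : mu, clt a0 a1 /\
          forall (j0 : below i0) (j1 : below i1),
            c (upair (disj a0 j0 a1 j1)) = gamma].

Definition Pr1_same (lambda mu sigma theta : cardinal) : Prop :=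
  Pr1 lambda mu sigma theta theta.

(* Main.v *)
Require Import Defs.
From Stdlib Require List.
From mathcomp Require Import all_boot.
From mathcomp Require Import boolp wochoice classical_sets functions cardinality.

(** Walk along the ordinals below [lambda]: each step from [b] towards [xi] has a weight
    in [partial]. Every ordinal of cofinality [partial] carries three labels, a color
    in [lambda], [l1] in [theta^+] and [l2] in [partial], such that all triples of
    labels occur stationarily often. Fix a family of sets of size less than [theta].

    For suitable [m] of cofinality [partial], all walks from a set [b] high above [m]
    to a set [a] close below [m] pass through [m]. One has many "tops", walks from some
    [b] through a point [ga] of the wanted color with [l1 ga = j] to [m], where the
    weight at [ga] can be made large while the weights before [ga] are at most [eps];
    and many "bottoms", walks from [m] through a point with labels [l1 = i], [l2 = z] to
    some [a]. Tops and bottoms can be combined freely, and it remains to recognize [ga]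
    in the combined walk by a rule that depends on the walk only.

    Injections [e u] of [u < theta^+] into [theta] make the pairs of labels [l1] with
    one component of the top and one of the bottom those on which [e] is large; this
    yields a step of the top that is not above [ga]. Since [theta^+ < partial] there is a
    club guessing sequence of ladders [a z] at ordinals [z < partial] of cofinality
    [theta]. If the ladder of the label [z] guesses the club of ordinals closed under
    the bounds on the weights of the tops, then the later weights of the top have the same
    index in it as the weight at [ga], while the weights before [ga] have a smaller one:
    so [ga] is the first step of the top whose index is maximal. *)

Set Implicit Arguments.
Unset Strict Implicit.
Unset Printing Implicit Defensive.

Local Open Scope classical_set_scope.
Local Open Scope card_scope.

Notation "x <o y" := (clt x y) (at level 70).
Notation "x <=o y" := (cle x y) (at level 70).

(** * Well-orders *)

Section Order.
Context {X : cardinal}.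
Implicit Types x y z : X.

Lemma ex_least (P : X -> Prop) :
  (exists x, P x) -> exists x, P x /\ forall y, P y -> x <=o y.
Proof.
move=> [x Px]; have [|z [[Pz zmin] _]] := @cle_wo X (fun y => `[< P y >]).
  by exists x; apply/asboolP.
exists z; split; first exact/asboolP.
by move=> y Py; apply: zmin; apply/asboolP.
Qed.

Lemma cle_refl x : x <=o x.
Proof. by have [|z [-> zmin]] := @ex_least (eq x); [exists x | exact: zmin]. Qed.

Lemma cle_total x y : x <=o y \/ y <=o x.
Proof.
have [|z [zxy zmin]] := @ex_least (fun z => z = x \/ z = y); first by exists x; left.
case: zxy => zE; rewrite zE in zmin; first by left; apply: zmin; right.
by right; apply: zmin; left.
Qed.

Lemma cle_anti x y : x <=o y -> y <=o x -> x = y.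
Proof.
move=> xy yx; have [|z [_ zuniq]] := @cle_wo X (fun z => `[< z = x \/ z = y >]).
  by exists x; apply/asboolP; left.
have H t (t_xy : t = x \/ t = y) : z = t.
  apply: zuniq; split; first exact/asboolP.
  by move=> u /asboolP uE; case: t_xy uE => -> [] -> //; exact: cle_refl.
by rewrite -(H x) ?(H y); auto.
Qed.

Lemma cltNge x y : (x <o y) = ~~ (y <=o x).
Proof. by []. Qed.

Lemma cleNgt x y : (x <=o y) = ~~ (y <o x).
Proof. by rewrite /clt negbK. Qed.

Lemma cltP x y : x <o y \/ y <=o x.
Proof. by rewrite cltNge; case: (y <=o x); [right | left]. Qed.

Lemma cltW x y : x <o y -> x <=o y.
Proof. by rewrite cltNge; case: (cle_total x y) => [//|->]. Qed.

Lemma clt_irr x : ~ x <o x.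
Proof. by rewrite /clt cle_refl. Qed.

Lemma cle_trans y x z : x <=o y -> y <=o z -> x <=o z.
Proof.
move=> xy yz.
have [|t [tE tmin]] := @ex_least (fun t => [\/ t = x, t = y | t = z]).
  by exists x; constructor 1.
have tx : t <=o x by apply: tmin; constructor 1.
have ty : t <=o y by apply: tmin; constructor 2.
have tz : t <=o z by apply: tmin; constructor 3.
case: tE => tE; rewrite tE in tx ty tz => //.
  by rewrite (cle_anti xy tx).
by rewrite -(cle_anti yz ty).
Qed.

Lemma cle_lt_trans y x z : x <=o y -> y <o z -> x <o z.
Proof. by move=> xy; apply: contra => zx; apply: cle_trans xy. Qed.

Lemma clt_le_trans y x z : x <o y -> y <=o z -> x <o z.
Proof. by move=> xy yz; apply: contra xy => zx; apply: cle_trans zx. Qed.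

Lemma clt_trans y x z : x <o y -> y <o z -> x <o z.
Proof. by move=> /cltW; apply: cle_lt_trans. Qed.

Lemma clt_asym x y : x <o y -> ~ y <o x.
Proof. by move=> xy yx; apply: (@clt_irr x); apply: clt_trans yx. Qed.

Lemma cle_ltF x y : x <=o y -> ~ y <o x.
Proof. by rewrite /clt => ->. Qed.

Lemma cle_eqVlt x y : x <=o y -> x = y \/ x <o y.
Proof. by case: (cltP x y) => [|yx xy]; [right | left; apply: cle_anti]. Qed.

Lemma clt_neq x y : x <o y -> x <> y.
Proof. by move=> xy E; rewrite E in xy; exact: clt_irr xy. Qed.

Lemma clt_trich x y : [\/ x <o y, x = y | y <o x].
Proof.
case: (cltP x y) => [|/cle_eqVlt [->|]]; first by constructor 1.
  by constructor 2.
by constructor 3.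
Qed.

Lemma clt_ind (P : X -> Prop) :
  (forall x, (forall y, y <o x -> P y) -> P x) -> forall x, P x.
Proof.
move=> IH x; apply: contrapT => nPx.
have [z [nPz zmin]] := @ex_least (fun z => ~ P z) (ex_intro _ x nPx).
apply: nPz; apply: IH => y yz; apply: contrapT => /zmin.
exact/negP.
Qed.

Lemma clt_wf : well_founded (fun x y => x <o y).
Proof. by move=> x; elim/clt_ind: x => x IH; constructor. Qed.

Definition cmax x y := if x <=o y then y else x.

Lemma cmaxl x y : x <=o cmax x y.
Proof. by rewrite /cmax; case: ifP => // _; exact: cle_refl. Qed.

Lemma cmaxr x y : y <=o cmax x y.
Proof.
rewrite /cmax; case: ifP => [_|xy]; first exact: cle_refl.
by case: (cle_total x y); rewrite ?xy.
Qed.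

Lemma cmax_lt x y z : x <o z -> y <o z -> cmax x y <o z.
Proof. by rewrite /cmax; case: ifP. Qed.

Lemma seq_bound (x0 : X) (T : Type) (f : T -> X) (s : seq T) :
  exists b, forall t, List.In t s -> f t <=o b.
Proof.
elim: s => [|t s [b IH]]; first by exists x0.
exists (cmax (f t) b) => u [<-|/IH ub]; first exact: cmaxl.
exact: cle_trans ub (cmaxr _ _).
Qed.

Lemma seq_max (T : Type) (f : T -> X) (P : T -> Prop) (s : seq T) :
  (exists2 t, List.In t s & P t) ->
  exists t, [/\ List.In t s, P t & forall u, List.In u s -> P u -> f u <=o f t].
Proof.
elim: s => [[] //|t s IH] [u us Pu].
case: (pselect (exists2 v, List.In v s & P v)) => [/IH [v [vs Pv vmax]]|nv].
  case: (pselect (P t)) => Pt; last first.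
    by exists v; split=> //; [right | move=> w [<- //|]; exact: vmax].
  case: (cle_total (f t) (f v)) => tv.
    by exists v; split=> //; [right | move=> w [<- //|]; exact: vmax].
  exists t; split=> //; first by left.
  move=> w [<- _|ws Pw]; first exact: cle_refl.
  exact: cle_trans (vmax _ ws Pw) tv.
have tu : t = u by case: us => // us; case: nv; exists u.
exists t; split; [by left | by rewrite tu |].
move=> v [<- _|vs Pv]; first exact: cle_refl.
by case: nv; exists v.
Qed.

End Order.

(** * Boundedness and regularity *)

Definition embeds (T U : Type) : Prop := exists f : T -> U, injective f.

Lemma sval_inj (T : Type) (P : T -> Prop) : injective (@sval T P).
Proof. by move=> [x Px] [y Py] /= E; exact: eq_exist. Qed.

Lemma card_le_embeds (T U : Type) (A : set T) (B : set U) :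
  (A #<= B) <-> embeds {x | A x} {x | B x}.
Proof.
split=> [/card_leP [f]|[f finj]].
  exists (fun x : {x | A x} =>
    let y := f (SigSub (mem_set (svalP x))) in exist B (val y) (set_valP y)).
  move=> [x Ax] [y Ay] /= [] /val_inj /(@inj _ _ _ f) E.
  have {}E := E (in_setT _) (in_setT _).
  by apply: eq_exist; case: E.
apply/card_leP.
have gP (x : A) : B (sval (f (exist A (val x) (set_valP x)))) by exact: svalP.
pose g (x : A) : B := SigSub (mem_set (gP x)).
have ginj : {in [set: A] &, injective g}.
  move=> x y _ _ [] E; apply: val_inj.
  by have /finj [] : f (exist A (val x) (set_valP x)) = f (exist A (val y) (set_valP y))
    by apply: sval_inj.
have [h hg] := Pinj ginj.
by squash ('totalfun_[set: A] h).
Qed.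

Lemma cardT_le_embeds (T U : Type) : ([set: T] #<= [set: U]) <-> embeds T U.
Proof.
rewrite card_le_embeds; split=> -[f finj].
  exists (fun x => sval (f (exist _ x I))) => x y E.
  by have /finj [] : f (exist _ x I) = f (exist _ y I) by apply: sval_inj.
exists (fun x => exist [set: U] (f (sval x)) I) => -[x []] [y []] [] /finj /= ->.
by [].
Qed.

Lemma embeds_trans (U T V : Type) : embeds T U -> embeds U V -> embeds T V.
Proof. by move=> [f fi] [g gi]; exists (g \o f); exact: inj_comp. Qed.

Definition pred_below (X : cardinal) (x y : X) (yx : y <o x) : below x := exist _ y yx.

Lemma embeds_below (X : cardinal) (x : X) : embeds (below x) X.
Proof. by exists sval; exact: sval_inj. Qed.

Lemma below_small (X : cardinal) (x : X) : ~ embeds X (below x).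
Proof.
move=> E; apply: (@cardinal_initial X x); apply/card_le_embeds.
by case: E => f fi; exists (fun t => f (sval t)) => a b /fi; apply: sval_inj.
Qed.

Definition bounds (T : Type) (X : cardinal) : Prop :=
  forall f : T -> X, exists b, forall t, f t <o b.

Lemma regular_bounds (X : cardinal) (T : Type) :
  regular X -> ~ embeds X T -> bounds T X.
Proof.
move=> [_ Xreg] XT f; apply: contrapT => nb; apply: XT.
have /Xreg : cofinal (range f).
  move=> x; apply: contrapT => nx; apply: nb; exists x => t.
  by rewrite cltNge; apply/negP => xt; apply: nx; exists (f t).
by move=> /card_le_trans /(_ (card_image_le _ _)) /cardT_le_embeds.
Qed.

Definition nomax (X : cardinal) : Prop := forall x : X, exists y, x <o y.

Definition breg (X : cardinal) : Prop :=
  nomax X /\ forall x : X, bounds (below x) X.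

Lemma regular_point (X : cardinal) : regular X -> inhabited X.
Proof.
move=> [Xinf _]; apply: contrapT => nX; apply: Xinf.
suff -> : [set: X] = set0 by exact: finite_set0.
by rewrite -subset0 => x _; apply: nX.
Qed.

Lemma regular_breg (X : cardinal) : regular X -> breg X.
Proof.
move=> Xreg; split=> [x|x]; last exact: (regular_bounds Xreg (@below_small X x)).
have [|b /(_ tt) xb] := regular_bounds (T := unit) Xreg _ (fun=> x); last by exists b.
case=> f fi; case: (Xreg.1); suff -> : [set: X] = [set x] by exact: finite_set1.
by apply/seteqP; split=> // y _; apply: fi; case: (f y); case: (f x).
Qed.

Lemma bounds_embeds (X : cardinal) (T U : Type) :
  inhabited X -> embeds T U -> bounds U X -> bounds T X.
Proof.
move=> [x0] [g gi] UX f.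
pose f' u := if pselect (exists t, g t = u) is left e then f (projT1 (cid e)) else x0.
have [b bP] := UX f'; exists b => t; have := bP (g t); rewrite /f'.
case: pselect => [e|[]]; last by exists t.
by case: cid => u /= /gi ->.
Qed.

(** The fibres of the first coordinate of [g] inject into [V], so each is bounded, and the bounds
    have a common bound [c]; but [c] lies in one of the fibres. *)
Lemma small_prod (X : cardinal) (K V : Type) :
  regular X -> ~ embeds X K -> ~ embeds X V -> ~ embeds X (K * V).
Proof.
move=> Xreg XK XV [g gi].
have fib v : exists b, forall x, (g x).1 = v -> x <o b.
  have [|b bP] := regular_bounds (T := {x : X | (g x).1 = v}) Xreg _ sval.
    move=> E; apply: XV; apply: embeds_trans E _.
    exists (fun x => (g (sval x)).2) => -[x xv] [y yv] /= E; apply: eq_exist; apply: gi.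
    by rewrite (surjective_pairing (g x)) (surjective_pairing (g y)) xv yv E.
  by exists b => x xv; exact: (bP (exist _ x xv)).
have [b bP] := choice fib; have [c cP] := regular_bounds Xreg XK b.
apply: (@clt_irr _ c); apply: clt_trans (cP (g c).1).
exact: bP.
Qed.

(** Recursion along [R]: values on a segment never exhaust [M], since choosing preimages would embed
    [M] into the segment, so a fresh value remains at each point. *)
Lemma embeds_of_small_segments (T M : Type) (R : T -> T -> Prop) :
  well_founded R -> (forall p q, [\/ R p q, p = q | R q p]) ->
  (forall p, ~ embeds M {q | R q p}) -> embeds T M.
Proof.
move=> Rwf Rtot Rsmall.
have fresh p (f : forall q, R q p -> M) : exists y, forall q (qp : R q p), f q qp <> y.
  apply: contrapT => nf; apply: (Rsmall p).
  have sur y : exists q : {q | R q p}, f (sval q) (proj2_sig q) = y.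
    by apply: contrapT => ny; apply: nf; exists y => q qp E; apply: ny; exists (exist _ q qp).
  have [h hP] := choice sur; exists h => x y E.
  by rewrite -(hP x) -(hP y) E.
pose F := Fix Rwf (fun=> M) (fun p f => projT1 (cid (fresh p f))).
have Feq p : F p = projT1 (cid (fresh p (fun q _ => F q))).
  rewrite /F Fix_eq // => x f g fg; suff -> : f = g by [].
  apply: functional_extensionality_dep => y; apply: functional_extensionality_dep => r.
  exact: fg.
have FE p : forall q, R q p -> F q <> F p.
  by move=> q qp; rewrite [X in _ <> X]Feq; case: cid => y /= yP; exact: (yP q qp).
exists F => p q E; case: (Rtot p q) => // /FE; first by rewrite E.
by move=> /(_ (esym E)).
Qed.

(** Goedel's ordering of pairs: with the maximum compared first, every segment fits into the square
    of a bounded set. *)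
Definition maxlex (X : cardinal) (p q : X * X) : Prop :=
  cmax p.1 p.2 <o cmax q.1 q.2 \/
  cmax p.1 p.2 = cmax q.1 q.2 /\ (p.1 <o q.1 \/ p.1 = q.1 /\ p.2 <o q.2).

Lemma maxlex_wf (X : cardinal) : well_founded (@maxlex X).
Proof.
suff H m : forall x y : X, cmax x y = m -> Acc (@maxlex X) (x, y) by case=> x y; exact: H.
elim/(@clt_ind X): m => m IHm x; elim/(@clt_ind X): x => x IHx y; elim/(@clt_ind X): y => y IHy E.
constructor=> -[u v]; rewrite /maxlex /= E => -[lt|[E' [ux|[uE vy]]]].
- exact: (IHm _ lt).
- exact: (IHx _ ux).
- by rewrite uE; apply: (IHy _ vy); rewrite -uE.
Qed.

Lemma regular_square (X : cardinal) : regular X -> embeds (X * X) X.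
Proof.
move=> Xreg; apply: (embeds_of_small_segments (@maxlex_wf X)).
  move=> [a b] [c d]; rewrite /maxlex /=.
  case: (clt_trich (cmax a b) (cmax c d)) => [||]; [by constructor 1; left| |by constructor 3; left].
  move=> E; case: (clt_trich a c) => [ac|ac|ac].
  - by constructor 1; right; split=> //; left.
  - subst c; case: (clt_trich b d) => [bd|->|bd]; [|by constructor 2|].
      by constructor 1; right; split=> //; right.
    by constructor 3; right; split=> //; right.
  - by constructor 3; right; split=> //; left.
move=> [a b]; have [c cP] := (regular_breg Xreg).1 (cmax a b).
have small := small_prod Xreg (@below_small X c) (@below_small X c).
move=> E; apply: small; apply: embeds_trans E _.
have H (q : {q | maxlex q (a, b)}) : (sval q).1 <o c /\ (sval q).2 <o c.
  case: q => -[x y] /=; rewrite /maxlex /= => H.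
  have xyc : cmax x y <o c by case: H => [/clt_trans|[-> _]] //; exact.
  by split; apply: cle_lt_trans xyc; [exact: cmaxl | exact: cmaxr].
exists (fun q => (pred_below (H q).1, pred_below (H q).2)).
move=> p q [E1 E2]; apply: sval_inj.
by rewrite (surjective_pairing (sval p)) (surjective_pairing (sval q)) E1 E2.
Qed.

(** * Successor cardinals *)

Section Succ.
Context {K L : cardinal} (Kreg : regular K) (KL : is_succ K L).

(** For the least counterexample [y], [below y] is an initial ordinal [M] above [K]; minimality of
    the successor would embed [L] into its proper segment [M]. *)
Lemma succ_below (x : L) : embeds (below x) K.
Proof.
apply: contrapT => nx.
have [y [ny ymin]] := @ex_least L (fun y => ~ embeds (below y) K) (ex_intro _ x nx).
have yle (u : L) : u <o y -> embeds (below u) K.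
  by move=> uy; apply: contrapT => /ymin; exact/negP.
pose R (a b : below y) := sval a <=o sval b.
have Rwo : well_order R.
  move=> A [a0 Aa0].
  have [|z [[zy Az] zmin]] := @ex_least L (fun z => exists zy : z <o y, pred_below zy \in A).
    by case: a0 Aa0 => z zy Az; exists z, zy.
  have zm b : b \in A -> R (pred_below zy) b.
    by case: b => b yb bA; apply: zmin; exists yb.
  exists (pred_below zy); split; first by split=> // b /zm.
  move=> b [bA bm]; apply: sval_inj; apply: cle_anti; first exact: zm.
  exact: (bm _ Az).
have Rini (a : below y) : ~ ([set: below y] #<= [set b | ~~ R a b]).
  move=> /card_le_embeds E; apply: ny; apply: embeds_trans (yle _ (svalP a)).
  case: E => f fi.
  exists (fun b : below y => exist (fun u => u <o sval a) (sval (sval (f (exist _ b I))))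
     (svalP (f (exist _ b I)))).
  by move=> b c [] /sval_inj /sval_inj /fi [].
pose M := Cardinal Rwo Rini.
have KM : card_lt K M.
  split; last by move=> /cardT_le_embeds.
  apply/cardT_le_embeds; apply: (embeds_of_small_segments (@clt_wf K)).
    exact: clt_trich.
  move=> p E; apply: ny; apply: embeds_trans E _; exact: embeds_below.
have /cardT_le_embeds := KL.2 _ KM.
exact: below_small.
Qed.

Lemma succ_enum : exists e : L -> L -> K,
  forall x y z, y <o x -> z <o x -> e x y = e x z -> y = z.
Proof.
have [k0] := regular_point Kreg.
suff H x : exists f : L -> K, forall y z, y <o x -> z <o x -> f y = f z -> y = z.
  by have [e eP] := choice H; exists e.
have [g gi] := succ_below x.
exists (fun y => if pselect (y <o x) is left h then g (pred_below h) else k0).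
move=> y z yx zx; case: pselect => // h; case: pselect => // h' /gi [].
by [].
Qed.

(** Otherwise [L] embeds into [K * K]: send [x] to an index [k] with [x <o f k] and to the code of
    [x] among the predecessors of [f k]. *)
Lemma succ_bounds : bounds K L.
Proof.
move=> f; apply: contrapT => nb.
have H x : exists k, x <=o f k.
  apply: contrapT => nx; apply: nb; exists x => k; rewrite cltNge; apply/negP => xk.
  by apply: nx; exists k.
have [g gP] := choice H; have [e ei] := succ_enum.
have [/cardT_le_embeds KleL nLK] := KL.1.
have [x0] : inhabited L by case: (regular_point Kreg) => k; constructor; exact: (f k).
have Lno (x : L) : exists y, x <o y.
  apply: contrapT => nx; apply: nb; exists x => k; rewrite cltNge; apply/negP => xk.
  have Ex : f k = x.
    by apply: cle_anti => //; rewrite cleNgt; apply/negP => ?; apply: nx; exists (f k).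
  have xm y : y <=o x by rewrite cleNgt; apply/negP => ?; apply: nx; exists y.
  have LU : embeds L (option (below x)).
    exists (fun y => if pselect (y <o x) is left h then Some (exist _ y h) else None).
    move=> y z; case: pselect => yx; case: pselect => zx //; first by case.
    have aux w : ~ w <o x -> w = x by case: (cle_eqVlt (xm w)).
    by rewrite (aux y) // (aux z).
  have UK : embeds (option K) K.
    have [sq sqi] := regular_square Kreg.
    have [k0] := regular_point Kreg; have [k1 k01] := (regular_breg Kreg).1 k0.
    exists (fun o => if o is Some u then sq (k0, u) else sq (k1, k1)).
    have k10 : k1 <> k0 by move=> E; rewrite E in k01; exact: clt_irr k01.
    case=> [u|] [v|] // /sqi [].
    - by move=> ->.
    - by move=> /esym.
    - by move=> /k10.
  apply: nLK; apply/cardT_le_embeds; apply: embeds_trans LU _; apply: embeds_trans UK.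
  have [h hi] := succ_below x; exists (omap h).
  by case=> [u|] [v|] //= [] /hi ->.
have H' (x : L) : exists k, x <o f k.
  have [y xy] := Lno x; have [k yk] := H y; exists k; exact: clt_le_trans yk.
have [g' gP'] := choice H'.
apply: nLK; apply/cardT_le_embeds; apply: embeds_trans (regular_square Kreg).
exists (fun x => (g' x, e (f (g' x)) x)) => x y [E].
by have := gP' x; rewrite E => xy; exact: ei (gP' y).
Qed.

End Succ.

(** [L] is embedded into a cofinal set by recursion; a failure at [p] would embed that set into
    [below p], hence into [K], and [succ_bounds] would bound it. *)
Lemma succ_regular (K L : cardinal) : regular K -> is_succ K L -> regular L.
Proof.
move=> Kreg KL; have [l0] : inhabited L.
  by have [/cardT_le_embeds [f _] _] := KL.1; have [k] := regular_point Kreg; constructor; exact: f.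
split=> [Lfin|A Acof].
  by apply: (Kreg.1); apply: card_le_finite Lfin; exact: KL.1.1.
have LA : embeds L {x | A x}.
  apply: (embeds_of_small_segments (@clt_wf L)); first exact: clt_trich.
  move=> p Ap; have pK := embeds_trans Ap (succ_below KL p).
  have [b bP] := bounds_embeds (inhabits l0) pK (succ_bounds Kreg KL) sval.
  by have [y Ay /cle_ltF] := Acof b; apply; exact: (bP (exist _ y Ay)).
apply/card_le_embeds; case: LA => f fi; exists (fun x => f (sval x)).
by move=> x y /fi; exact: sval_inj.
Qed.

(** * Closure points, ladders and stationary sets *)

Definition closed_under (X : cardinal) (F : X -> X) (x : X) : Prop :=
  forall y, y <o x -> F y <o x.

(* [x] has the cofinality of [M], witnessed by [s]. *)
Definition ladder (M X : cardinal) (x : X) (s : M -> X) : Prop :=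
  [/\ forall k, s k <o x,
      forall k k', k <=o k' -> s k <=o s k' &
      forall w, w <o x -> exists k, w <o s k].

(* Clubs are represented by the closure points of functions [F : X -> X]. *)
Definition stat (X : cardinal) (T : X -> Prop) : Prop :=
  forall (F : X -> X) t, exists x, [/\ T x, t <o x & closed_under F x].

Lemma bound_le (X : cardinal) (f : X -> X) (v : X) :
  regular X -> exists b, forall u, u <=o v -> f u <o b.
Proof.
move=> /regular_breg [Xno Xb]; have [w vw] := Xno v.
have [b bP] := Xb w (fun u => f (sval u)).
by exists b => u uv; exact: (bP (pred_below (cle_lt_trans uv vw))).
Qed.

Lemma ladder_bound (M X : cardinal) (x : X) (s : M -> X) (T : Type) (h : T -> X) :
  regular M -> ~ embeds M T -> ladder x s -> (forall v, h v <o x) ->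
  exists k, forall v, h v <o s k.
Proof.
move=> Mreg MT [sx smono scof] hx.
have [f fP] := choice (fun v => scof _ (hx v)).
have [k kP] := regular_bounds Mreg MT f.
by exists k => v; apply: clt_le_trans (fP v) _; apply: smono; exact: cltW.
Qed.

Lemma ladder_closed (M X : cardinal) (F : X -> X) (t : X) :
  regular M -> regular X -> ~ embeds X M ->
  exists (x : X) (s : M -> X), [/\ t <o x, closed_under F x & ladder x s].
Proof.
move=> Mreg Xreg XM.
(* [G v] bounds [F] on all points up to [v], so closure of [x] can be read off from the cofinal
   points [s k]. *)
have [G GP] := choice (fun v => bound_le F v Xreg).
have step (k : M) (f : forall k', k' <o k -> X) : exists b, t <o b /\
    forall k' (kk' : k' <o k), f k' kk' <o b /\ G (f k' kk') <o b.
  have small : ~ embeds X (below k).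
    by move=> E; apply: XM; exact: (embeds_trans E (embeds_below k)).
  have [b bP] := regular_bounds Xreg small
    (fun v => cmax (cmax t (f _ (svalP v))) (G (f _ (svalP v)))).
  have [c tc] := (regular_breg Xreg).1 t.
  exists (cmax b c); split; first exact: clt_le_trans tc (cmaxr _ _).
  move=> k' kk'; have := bP (pred_below kk').
  have -> : svalP (pred_below kk') = kk' by exact: Prop_irrelevance.
  move=> fb; split; apply: clt_le_trans (cmaxl _ _); apply: cle_lt_trans fb.
    exact: cle_trans (cmaxr _ _) (cmaxl _ _).
  exact: cmaxr.
pose s := Fix (@clt_wf M) (fun=> X) (fun k f => projT1 (cid (step k f))).
have sE k : s k = projT1 (cid (step k (fun k' _ => s k'))).
  rewrite /s Fix_eq // => y f g fg; suff -> : f = g by [].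
  apply: functional_extensionality_dep => u; apply: functional_extensionality_dep => r.
  exact: fg.
have sP k : t <o s k /\ forall k', k' <o k -> s k' <o s k /\ G (s k') <o s k.
  by rewrite [s k]sE; case: cid.
have [x [xP xmin]] := ex_least (regular_bounds Xreg XM s).
have cof w : w <o x -> exists k, w <=o s k.
  move=> wx; apply: contrapT => nw; apply: (clt_asym wx).
  apply: contrapT => _; apply: (cle_ltF _ wx); apply: xmin => k.
  by rewrite cltNge; apply/negP => wk; apply: nw; exists k.
have Mno := (regular_breg Mreg).1; have [k0] := regular_point Mreg.
exists x, s; split.
- exact: clt_trans (sP k0).1 (xP k0).
- move=> w /cof [k wk]; have [k' kk'] := Mno k.
  by apply: clt_trans (GP _ _ wk) _; apply: clt_trans ((sP k').2 _ kk').2 (xP k').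
- split=> // [k k' /cle_eqVlt [-> |kk']|w /cof [k wk]]; first exact: cle_refl.
    exact: cltW ((sP k').2 _ kk').1.
  have [k' kk'] := Mno k; exists k'; exact: cle_lt_trans wk ((sP k').2 _ kk').1.
Qed.

Lemma stat_ladder (M X : cardinal) : regular M -> regular X -> ~ embeds X M ->
  stat (fun x : X => exists s : M -> X, ladder x s).
Proof.
move=> Mreg Xreg XM F t; have [x [s [tx Fx xs]]] := ladder_closed F t Mreg Xreg XM.
by exists x; split=> //; exists s.
Qed.

Lemma stat_sub (X : cardinal) (T U : X -> Prop) :
  stat T -> (forall x, T x -> U x) -> stat U.
Proof. by move=> Ts TU F t; have [x [/TU]] := Ts F t; exists x. Qed.

Lemma stat_closed (X : cardinal) (T : X -> Prop) (F : X -> X) (t : X) :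
  stat T -> stat (fun x => [/\ T x, closed_under F x & t <o x]).
Proof.
move=> Ts G u.
have [x [Tx tx Gx]] := Ts (fun v => cmax (F v) (G v)) (cmax t u).
exists x; split; [split=> // | | ].
- by move=> v /Gx; apply: cle_lt_trans; exact: cmaxl.
- exact: cle_lt_trans (cmaxl _ _) tx.
- exact: cle_lt_trans (cmaxr _ _) tx.
- by move=> v /Gx; apply: cle_lt_trans; exact: cmaxr.
Qed.

Lemma nstatP (X : cardinal) (T : X -> Prop) : ~ stat T ->
  exists Ft : (X -> X) * X, forall x, T x -> Ft.2 <o x -> ~ closed_under Ft.1 x.
Proof.
move=> nT; apply: contrapT => nF; apply: nT => F t.
apply: contrapT => nx; apply: nF; exists (F, t) => x Tx tx Fx.
by apply: nx; exists x.
Qed.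

(** A point [x] closed under the diagonal bound [G] lies in the club attached to each [y <o x], in
    particular in the one for [r x], which it was to avoid. *)
Lemma fodor (X : cardinal) (T : X -> Prop) (r : X -> X) : regular X -> stat T ->
  (forall x, T x -> r x <o x) -> exists y, stat (fun x => T x /\ r x = y).
Proof.
move=> Xreg Ts Tr; apply: contrapT => ny.
have H y : ~ stat (fun x => T x /\ r x = y) by move=> ?; apply: ny; exists y.
have [F FP] := choice (fun y => nstatP (H y)).
have H1 v : exists b, forall y, y <=o v -> forall u, u <=o v -> (F y).1 u <o b /\ (F y).2 <o b.
  have [g gP] := choice (fun y => bound_le (fun u => cmax ((F y).1 u) (F y).2) v Xreg).
  have [b bP] := bound_le g v Xreg; exists b => y yv u uv.
  have lb := clt_trans (gP y u uv) (bP y yv).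
  by split; apply: cle_lt_trans lb; [exact: cmaxl | exact: cmaxr].
have [G GP] := choice H1; have [t0] := regular_point Xreg.
have [x [Tx _ Gx]] := Ts G t0; have rx := Tr _ Tx.
apply: (FP (r x) x) => //.
  by apply: clt_trans (Gx _ rx); case: (GP _ _ (cle_refl _) _ (cle_refl (r x))).
move=> u ux; apply: clt_trans (Gx _ (cmax_lt rx ux)).
by case: (GP _ _ (cmaxl (r x) u) _ (cmaxr _ _)).
Qed.

Lemma stat_split (X : cardinal) (I : Type) (T : X -> Prop) (R : X -> I -> Prop) :
  regular X -> ~ embeds X I -> stat T -> (forall x, T x -> exists i, R x i) ->
  exists i, stat (fun x => T x /\ R x i).
Proof.
move=> Xreg XI Ts TR; apply: contrapT => ni.
have H i : ~ stat (fun x => T x /\ R x i) by move=> ?; apply: ni; exists i.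
have [F FP] := choice (fun y => nstatP (H y)).
have [G GP] := choice (fun v => regular_bounds Xreg XI (fun i => (F i).1 v)).
have [t tP] := regular_bounds Xreg XI (fun i => (F i).2).
have [x [Tx tx Gx]] := Ts G t; have [i xi] := TR _ Tx.
apply: (FP i x) => //; first exact: clt_trans tx.
by move=> u ux; apply: clt_trans (Gx _ ux).
Qed.

(** * Club guessing *)

Section Guess.
Context {P th tp : cardinal} (Preg : regular P) (threg : regular th) (tpreg : regular tp).
Context (Ptp : ~ embeds P tp) (tpth : ~ embeds tp th) (thtp : embeds th tp).

Let Pth : ~ embeds P th.
Proof. by move=> E; apply: Ptp; exact: (embeds_trans E thtp). Qed.

(** The supremum [d] of the closed points up to [x] is closed: if [t <o d <=o F t], no closed point
    up to [x] is above [t], so [t] is a smaller bound. *)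
Lemma last_closed (F : P -> P) (x : P) : exists d,
  [/\ d <=o x, closed_under F d & forall d', d' <=o x -> closed_under F d' -> d' <=o d].
Proof.
have [|d [dP dmin]] :=
    @ex_least P (fun d => forall d', d' <=o x -> closed_under F d' -> d' <=o d).
  by exists x.
exists d; split=> //; first exact: dmin.
move=> t td; apply: contrapT => /negP; rewrite -cleNgt => dFt.
suff : d <=o t by move/cle_ltF.
apply: dmin => d' d'x Fd'; rewrite cleNgt; apply/negP => td'.
exact: (cle_ltF (cle_trans (dP _ d'x Fd') dFt) (Fd' _ td')).
Qed.

Lemma last_closed_fun : exists p : (P -> P) -> P -> P,
  forall F x, [/\ p F x <=o x, closed_under F (p F x) &
                forall d, d <=o x -> closed_under F d -> d <=o p F x].
Proof.
have [p pP] := choice (fun Fx : (P -> P) * P => last_closed Fx.1 Fx.2).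
by exists (fun F x => p (F, x)) => F x; exact: (pP (F, x)).
Qed.

Definition limit_of_closed (F : P -> P) (z : P) : Prop :=
  forall w, w <o z -> exists d, [/\ w <o d, d <o z & closed_under F d].

Lemma limit_of_closed_ladder (F : P -> P) (t : P) :
  exists z (s : th -> P), [/\ t <o z, limit_of_closed F z & ladder z s].
Proof.
have H (w : P) : exists d, w <o d /\ closed_under F d.
  by have [x [s [wx Fx _]]] := ladder_closed F w threg Preg Pth; exists x.
have [G GP] := choice H.
have [z [s [tz Gz zs]]] := ladder_closed G t threg Preg Pth.
exists z, s; split=> // w wz; exists (G w); split; [exact: (GP w).1|exact: Gz|exact: (GP w).2].
Qed.

(* If no projected ladder system guesses, iterate its counterexamples [theta^+]
   times: the projections of a point to the shrinking clubs are nonincreasing,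
   hence eventually constant, at a stage below [theta^+] that is uniform along a
   ladder of length [theta]. *)
Theorem club_guessing : exists a : P -> th -> P, forall F : P -> P,
  exists z, ladder z (a z) /\ forall k, closed_under F (a z k).
Proof.
have [p pP] := last_closed_fun.
have [p0] := regular_point Preg.
have Hl (z : P) : exists s : th -> P, (exists s', ladder (M := th) z s') -> ladder z s.
  case: (pselect (exists s', ladder (M := th) z s')) => [[s sP]|n]; first by exists s.
  by exists (fun=> p0).
have [a0 a0P] := choice Hl.
apply: contrapT => nguess.
pose lim F z := limit_of_closed F z /\ exists s', ladder (M := th) z s'.
have lad F z : lim F z -> ladder z (fun k => p F (a0 z k)).
  move=> [Fz /a0P [az amono acof]]; split.
  - by move=> k; apply: cle_lt_trans (az k); case: (pP F (a0 z k)).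
  - move=> k k' /amono kk'; have [pa Fp _] := pP F (a0 z k).
    by have [_ _] := pP F (a0 z k'); apply=> //; exact: cle_trans kk'.
  - move=> w /Fz [d [wd /acof [k dk] Fd]]; exists k; apply: clt_le_trans wd _.
    by have [_ _] := pP F (a0 z k); apply=> //; exact: cltW.
have adv (F : P -> P) : exists F' : P -> P,
    forall z, lim F z -> exists k, ~ closed_under F' (p F (a0 z k)).
  apply: contrapT => nF'; apply: nguess.
  exists (fun z k => p F (a0 z k)) => F'; apply: contrapT => nz; apply: nF'.
  exists F' => z Fz; apply: contrapT => nk; apply: nz; exists z; split; first exact: lad.
  by move=> k; apply: contrapT => nc; apply: nk; exists k.
have [A AP] := choice adv.
(* [E i] is to dominate all earlier [E i'] and their counterexamples [A (E i')], so closure under it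
   implies closure under those. *)
have step (i : tp) (f : forall i', i' <o i -> P -> P) : exists G : P -> P,
    forall i' (h : i' <o i) t, A (f i' h) t <o G t /\ f i' h t <o G t.
  suff H (t : P) : exists b, forall i' (h : i' <o i), A (f i' h) t <o b /\ f i' h t <o b.
    by have [G GP] := choice H; exists G => i' h t; exact: GP.
  have small : ~ embeds P (below i).
    by move=> E; apply: Ptp; exact: (embeds_trans E (embeds_below i)).
  have [b bP] := regular_bounds Preg small
    (fun v => cmax (A (f _ (svalP v)) t) (f _ (svalP v) t)).
  exists b => i' h; have := bP (pred_below h).
  have -> : svalP (pred_below h) = h by exact: Prop_irrelevance.
  by move=> lb; split; apply: cle_lt_trans lb; [exact: cmaxl | exact: cmaxr].
pose E := Fix (@clt_wf tp) (fun=> P -> P) (fun i f => projT1 (cid (step i f))).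
have EE i : E i = projT1 (cid (step i (fun i' _ => E i'))).
  rewrite /E Fix_eq // => y f g fg; suff -> : f = g by [].
  apply: functional_extensionality_dep => u; apply: functional_extensionality_dep => r.
  exact: fg.
have EP (i i' : tp) t : i' <o i -> A (E i') t <o E i t /\ E i' t <o E i t.
  by move=> ii'; rewrite [E i]EE; case: cid => G GP; exact: (GP i' ii').
have [F FP] := choice (fun t => regular_bounds Preg Ptp (fun i => E i t)).
have [z [s [_ Fz zs]]] := limit_of_closed_ladder F p0.
have clE i d : closed_under F d -> closed_under (E i) d.
  by move=> Fd y yd; exact: clt_trans (FP y i) (Fd _ yd).
have Elim i : lim (E i) z.
  split; last by exists s.
  by move=> w /Fz [d [wd dz /(clE i) Ed]]; exists d.
have pmono i i' k : i' <=o i -> p (E i) (a0 z k) <=o p (E i') (a0 z k).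
  move=> /cle_eqVlt [->|ii']; first exact: cle_refl.
  have [pa Ep _] := pP (E i) (a0 z k).
  have [_ _] := pP (E i') (a0 z k); apply=> // y /Ep.
  exact: clt_trans (EP _ _ y ii').2.
have [i0] := regular_point tpreg.
have stab k : exists i, forall i', i <=o i' -> p (E i') (a0 z k) = p (E i) (a0 z k).
  have [|v [[i iv] vmin]] := @ex_least P (fun v => exists i, p (E i) (a0 z k) = v).
    by exists (p (E i0) (a0 z k)), i0.
  exists i => i' ii'; apply: cle_anti; first exact: pmono.
  by rewrite iv; apply: vmin; exists i'.
(* As [tp] is longer than [th], one stage [i] is past the stabilization of every rung. The rung [k]
   at which [A (E i)] should fail is unchanged at a later stage, hence closed under [A (E i)]. *)
have [g gP] := choice stab; have [i iP] := regular_bounds tpreg tpth g.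
have [k nk] := AP _ _ (Elim i); apply: nk.
have [i' ii'] := (regular_breg tpreg).1 i.
have -> : p (E i) (a0 z k) = p (E i') (a0 z k).
  by rewrite (gP k i (cltW (iP k))) (gP k i' (cltW (clt_trans (iP k) ii'))).
have [_ Ei' _] := pP (E i') (a0 z k) => y /Ei'.
exact: clt_trans (EP _ _ y ii').1.
Qed.

End Guess.

(** * Separating two families of small sets of labels *)

(* Stands for [|A| < theta]: this consequence of it is all that is needed. *)
Definition bounded_in (th : cardinal) (X : Type) (A : X -> Prop) : Prop :=
  forall f : X -> th, exists b, forall v, A v -> f v <o b.

Lemma bounded_in2 (th : cardinal) (X : Type) (A : X -> Prop) (f : X -> X -> th) :
  bounded_in th A -> exists b, forall u v, A u -> A v -> f u v <o b.
Proof.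
move=> Ath; have [g gP] := choice (fun u => Ath (f u)).
have [b bP] := Ath g; exists b => u v Au Av.
exact: clt_trans (gP u v Av) (bP u Au).
Qed.

Lemma bounded_inU (th : cardinal) (X : Type) (A B : X -> Prop) :
  bounded_in th A -> bounded_in th B -> bounded_in th (fun v => A v \/ B v).
Proof.
move=> Ath Bth f; have [a aP] := Ath f; have [b bP] := Bth f.
exists (cmax a b) => v [/aP|/bP] vb; apply: clt_le_trans vb _; [exact: cmaxl|exact: cmaxr].
Qed.

Section Separate.
Context {th tp : cardinal} (threg : regular th) (tpreg : regular tp).
Context (tpth : ~ embeds tp th).
Context (e : tp -> tp -> th).
Hypothesis e_inj : forall x y z, y <o x -> z <o x -> e x y = e x z -> y = z.

Definition cof_th (j : tp) : Prop := exists s : th -> tp, ladder j s.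

(* Two applications of Fodor's lemma; the second one uses that an ordinal below
   [theta^+] is a union of an increasing chain of [theta] small sets. *)
Lemma press_down (A : tp -> tp -> Prop) (J : tp -> Prop) :
  (forall j, bounded_in th (A j)) -> stat J -> (forall j, J j -> cof_th j) ->
  exists (Y : tp -> Prop) (zeta : tp), [/\ bounded_in th Y, forall v, Y v -> v <o zeta &
    stat (fun j => J j /\ forall v, A j v -> v <o j -> Y v)].
Proof.
move=> Ath Js Jcof; have [k0] := regular_point threg.
(* The cofinality of [j] is [th], so the part of the small set [A j] below [j] is bounded below [j];
   the bound is a regressive function. *)
have H (j : tp) : exists o, J j -> o <o j /\ forall v, A j v -> v <o j -> v <o o.
  case: (pselect (J j)) => [Jj|nJ]; last by exists j.
  have [s [sj smono scof]] := Jcof _ Jj.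
  have Hk (v : tp) : exists k, v <o j -> v <o s k.
    case: (pselect (v <o j)) => [/scof [k vk]|nv]; last by exists k0.
    by exists k.
  have [f fP] := choice Hk; have [b bP] := Ath j f.
  exists (s b) => _; split=> // v Av vj.
  by apply: clt_le_trans (fP v vj) _; apply: smono; apply: cltW; exact: bP.
have [r rP] := choice H.
have [zeta Jz] := fodor tpreg Js (fun j Jj => (rP j Jj).1).
have [|b Jb] := @stat_split tp th _ (fun j b => forall v, A j v -> v <o j -> e zeta v <o b)
  tpreg tpth Jz.
  by move=> j _; have [b bP] := Ath j (e zeta); exists b => v Av _; exact: bP.
exists (fun v => v <o zeta /\ e zeta v <o b), zeta; split.
- move=> f.
  (* [e zeta] is injective, so each value below [b] comes from at most one member of the set. *)
  have Hg (c : below b) : exists t, forall v, v <o zeta -> e zeta v = sval c -> f v <o t.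
    case: (pselect (exists v, v <o zeta /\ e zeta v = sval c)) => [[v [vz vc]]|nv].
      have [t vt] := (regular_breg threg).1 (f v); exists t => w wz wc.
      by rewrite (e_inj wz vz) // wc.
    by exists k0 => v vz vc; case: nv; exists v.
  have [g gP] := choice Hg; have [t tP] := (regular_breg threg).2 b g.
  exists t => v [vz vb]; apply: clt_trans (tP (pred_below vb)).
  exact: gP.
- by move=> v [].
- apply: (stat_sub Jb) => j [[Jj rj] jb]; split=> // v Av vj; split; last exact: jb.
  by rewrite -rj; exact: (rP j Jj).2.
Qed.

(** Both families are pressed down to a small set [Y]. A late choice of [i] below [j] makes [e]
    large between [A j] from [j] on and [B i] from [i] on; every other pair lies in [A j] or [B i]
    enlarged by [Y], where [e] was bounded beforehand. *)
Lemma separate_labels (A B : tp -> tp -> Prop) (J I : tp -> Prop) :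
  (forall j, bounded_in th (A j)) -> (forall i, bounded_in th (B i)) ->
  (forall i, exists b, forall v, B i v -> v <o b) ->
  stat J -> stat I -> (forall j, J j -> cof_th j) -> (forall i, I i -> cof_th i) ->
  exists (j i : tp) (b : th), [/\ J j, I i, forall v, B i v -> v <o j &
    forall u v, A j u \/ B i u -> A j v \/ B i v -> v <o u ->
      (j <=o u -> i <=o v -> v <o j -> b <o e u v) /\
      (~ [/\ j <=o u, i <=o v & v <o j] -> e u v <=o b)].
Proof.
move=> Ath Bth Bbd Js Is Jcof Icof.
have [Y1 [z1 [Y1th Y1z J1s]]] := press_down Ath Js Jcof.
have [Y2 [z2 [Y2th Y2z I1s]]] := press_down Bth Is Icof.
pose Y v := Y1 v \/ Y2 v; have Yth : bounded_in th Y by exact: bounded_inU.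
pose z := cmax z1 z2.
have Yz v : Y v -> v <o z.
  by case=> [/Y1z|/Y2z] vz; apply: clt_le_trans vz _; [exact: cmaxl|exact: cmaxr].
have [|b I2s] := @stat_split tp th _
  (fun i b => forall u v, B i u \/ Y u -> B i v \/ Y v -> e u v <o b) tpreg tpth I1s.
  move=> i _; have [b bP] := bounded_in2 e (bounded_inU (Bth i) Yth).
  by exists b.
have [sB sBP] := choice Bbd.
have I3s := stat_closed sB z I2s.
have Hn (x : tp) : exists i, x <o i /\
    [/\ ((I i /\ forall v, B i v -> v <o i -> Y2 v) /\
        forall u v, B i u \/ Y u -> B i v \/ Y v -> e u v <o b), closed_under sB i & z <o i].
  by have [i [Ii xi _]] := I3s id x; exists i.
have [nI nIP] := choice Hn.
(* Closure of [j] under this function keeps below [j] the [i] picked above a rung of [j], together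
   with all of [B i]. *)
have [j [[Jj jY1] zj jcl]] := J1s (fun x => cmax (nI x) (sB (nI x))) z.
have [s [sj smono scof]] := Jcof _ Jj; have jlad : ladder j s by [].
have [b1 b1P] := bounded_in2 e (bounded_inU (Ath j) Yth).
pose b' := cmax b b1.
pose bad u i := exists y, [/\ B i y, i <=o y, y <o j & e u y <=o b'].
pose good i := closed_under sB i /\ z <o i.
have Hbad (u : tp) : exists k, j <=o u -> forall i, good i -> i <o j -> bad u i -> i <o s k.
  have [b2 bb2] := (regular_breg threg).1 b'.
  case: (pselect (j <=o u)) => [ju|nju]; last by exists b.
  (* As [e u] is injective, the value [c] marks at most one [y]; the blocks of [B i] from [i] on are
     disjoint for different good [i], so [c] spoils at most one [i]. *)
  have Hc (c : below b2) : exists i, i <o j /\ forall i', good i' -> i' <o j ->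
      (exists y, [/\ B i' y, i' <=o y, y <o j & e u y = sval c]) -> i' = i.
    case: (pselect (exists i', [/\ good i', i' <o j &
        exists y, [/\ B i' y, i' <=o y, y <o j & e u y = sval c]])).
      move=> [i [gi ij [y [By iy yj yc]]]]; exists i; split=> // i' gi' i'j [y' [By' iy' yj' yc']].
      have yy' : y' = y.
        by apply: (e_inj (clt_le_trans yj' ju) (clt_le_trans yj ju)); rewrite yc.
      case: (clt_trich i' i) => // lt; exfalso.
        apply: (cle_ltF iy); rewrite -yy'.
        by apply: clt_trans (sBP _ _ By') _; apply: gi.1.
      apply: (cle_ltF iy'); rewrite yy'.
      by apply: clt_trans (sBP _ _ By) _; apply: gi'.1.
    by move=> ni; exists z; split=> // i' gi' i'j yP; case: ni; exists i'.
  have [h hP] := choice Hc.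
  have [k kP] := ladder_bound threg (@below_small th b2) jlad (fun c => (hP c).1).
  exists k => _ i gi ij [y [By iy yj yb]].
  have yb2 := cle_lt_trans yb bb2.
  rewrite ((hP (pred_below yb2)).2 i gi ij); first exact: kP.
  by exists y.
have [K KP] := choice Hbad; have [k kP] := Ath j K.
have skj := jcl _ (sj k).
have nj : nI (s k) <o j by apply: cle_lt_trans skj; exact: cmaxl.
have sBnj : sB (nI (s k)) <o j by apply: cle_lt_trans skj; exact: cmaxr.
have [ski [[[Ii iY2] ib] icl zi]] := nIP (s k).
move: (nI (s k)) ski Ii iY2 ib icl zi nj sBnj => i ski Ii iY2 ib icl zi ij sBj.
have Bj v : B i v -> v <o j by move=> /sBP vs; exact: clt_trans vs sBj.
have AY v : A j v -> v <o j -> Y v by move=> Av vj; left; exact: jY1.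
exists j, i, b'; split=> // u v uAB vAB vu; split.
  move=> ju iv vj.
  have Au : A j u by case: uAB => // /Bj; move/(cle_ltF ju).
  have Bv : B i v.
    case: vAB => // /AY /(_ vj) /Yz vz; case: (cle_ltF iv).
    exact: clt_trans vz zi.
  rewrite cltNge; apply/negP => uvb.
  apply: (clt_asym ski); apply: clt_le_trans (smono _ _ (cltW (kP _ Au))).
  by apply: KP => //; exists v.
move=> nT.
have inC : B i u \/ Y u -> B i v \/ Y v -> e u v <=o b'.
  by move=> uC vC; apply: cltW; apply: clt_le_trans (ib _ _ uC vC) (cmaxl _ _).
have inD : A j u \/ Y u -> A j v \/ Y v -> e u v <=o b'.
  by move=> uC vC; apply: cltW; apply: clt_le_trans (b1P _ _ uC vC) (cmaxr _ _).
case: uAB vAB => [Au|Bu] [Av|Bv].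
- by apply: inD; left.
- case: (cltP v i) => [vi|iv].
    by apply: inD; [left | right; right; exact: iY2].
  case: (cltP u j) => [uj|ju]; last by case: nT; split=> //; exact: Bj.
  by apply: inC; [right; exact: AY | left].
- by apply: inC; [left | right; apply: AY => //; apply: clt_trans vu _; exact: Bj].
- by apply: inC; left.
Qed.

End Separate.

(** * Disjoint stationary sets *)

(* Ulam's matrix. *)
Lemma stat_labels (K L : cardinal) (S : L -> Prop) (C : Type) (c0 : C) :
  regular K -> is_succ K L -> stat S -> embeds C L ->
  exists lab : L -> C, forall c, stat (fun x => S x /\ lab x = c).
Proof.
move=> Kreg KL Ss [h0 h0i].
have Lreg := succ_regular Kreg KL.
have LK : ~ embeds L K by move=> /cardT_le_embeds; exact: KL.1.2.
have [e ei] := succ_enum Kreg KL.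
have Hd (y : L) : exists d, stat (fun x => [/\ S x, closed_under id x & y <o x] /\ e x y = d).
  apply: (@stat_split L K _ (fun x d => e x y = d) Lreg LK (stat_closed id y Ss)) => x _.
  by exists (e x y).
have [d dP] := choice Hd.
(* There are only [K] values, so some [d0] is [d y] for cofinally many [y]; for these [y] the sets
   given by [e x y = d0] are disjoint, each [e x] being injective. *)
have [d0 d0P] : exists d0, forall b, exists y, b <=o y /\ d y = d0.
  apply: contrapT => nd.
  have Hb (d0 : K) : exists b, forall y, d y = d0 -> y <o b.
    apply: contrapT => nb; apply: nd; exists d0 => b; apply: contrapT => ny; apply: nb.
    by exists b => y yd; rewrite cltNge; apply/negP => yb; apply: ny; exists y.
  have [b bP] := choice Hb; have [c cP] := succ_bounds Kreg KL b.
  apply: (@clt_irr _ c); apply: clt_trans (cP (d c)); exact: bP.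
have [h1 h1i] : embeds L {y | d y = d0}.
  have /Lreg.2 /card_le_embeds [f fi] : cofinal [set y | d y = d0].
    by move=> x; have [y [xy yd]] := d0P x; exists y.
  by exists (fun x => f (exist _ x I)) => x y /fi [].
pose h c := sval (h1 (h0 c)).
have hd c : d (h c) = d0 by exact: (svalP (h1 (h0 c))).
have hi : injective h by move=> c c' /sval_inj /h1i /h0i.
have Hl (x : L) : exists c, forall c', h c' <o x -> e x (h c') = d0 -> c = c'.
  case: (pselect (exists c', h c' <o x /\ e x (h c') = d0)) => [[c [cx xc]]|nc].
    by exists c => c' cx' xc'; apply: hi; apply: (ei x) => //; rewrite xc.
  by exists c0 => c' cx xc; case: nc; exists c'.
have [lab labP] := choice Hl; exists lab => c.
apply: (stat_sub (dP (h c))) => x [[Sx _ cx] xc]; split=> //.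
by apply: labP => //; rewrite -(hd c).
Qed.

(** * Walks *)

Lemma in_cat (T : Type) (x : T) (s t : seq T) :
  List.In x (s ++ t) <-> List.In x s \/ List.In x t.
Proof. by elim: s => [|y s IH] /=; [split; auto; case | rewrite IH; tauto]. Qed.

(* [h b] enumerates the ordinals below [b]; the walk from [b] to [xi] moves to the
   first [h b d] that is at least [xi], and [wt b xi] is the weight [d] of this step. *)
Lemma walk_data (K L : cardinal) : regular K -> is_succ K L ->
  exists (h : L -> K -> L) (wt : L -> L -> K), forall b xi, xi <o b ->
    [/\ forall d, h b d <o b, xi <=o h b (wt b xi) & forall d, d <o wt b xi -> h b d <o xi].
Proof.
move=> Kreg KL.
have Hh (b : L) : exists h : K -> L, forall xi, xi <o b ->
    (forall d, h d <o b) /\ exists d, h d = xi.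
  case: (pselect (exists x, x <o b)) => [[x0 x0b]|nx]; last first.
    by exists (fun=> b) => xi xb; case: nx; exists xi.
  have [f fi] := succ_below KL b.
  have Hd (d : K) : exists x, x <o b /\ forall y : below b, f y = d -> sval y = x.
    case: (pselect (exists y, f y = d)) => [[y yd]|ny].
      by exists (sval y); split=> [|y']; [exact: (svalP y) | rewrite -yd => /fi ->].
    by exists x0; split=> // y yd; case: ny; exists y.
  have [h hP] := choice Hd; exists h => xi xb; split=> [d|]; first exact: (hP d).1.
  exists (f (pred_below xb)); symmetry.
  exact: ((hP (f (pred_below xb))).2 (pred_below xb)).
have [h hP] := choice Hh; have [k0] := regular_point Kreg.
have Hw (bx : L * L) : exists d, bx.2 <o bx.1 ->
    bx.2 <=o h bx.1 d /\ forall d', d' <o d -> h bx.1 d' <o bx.2.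
  case: bx => b xi /=; case: (pselect (xi <o b)) => [xb|nx]; last by exists k0.
  have [|d [dP dmin]] := @ex_least K (fun d => xi <=o h b d).
    by have [_ [d dE]] := hP b xi xb; exists d; rewrite dE; exact: cle_refl.
  exists d => _; split=> // d' d'd; rewrite cltNge; apply/negP => /dmin.
  by move/cle_ltF.
have [wt wtP] := choice Hw.
exists h, (fun b xi => wt (b, xi)) => b xi xb.
by have [] := wtP (b, xi) xb; split=> //; exact: (hP b xi xb).1.
Qed.

Section Walk.
Context {K L : cardinal} (Kreg : regular K).
Context (h : L -> K -> L) (wt : L -> L -> K).
Hypothesis hwtP : forall b xi, xi <o b ->
  [/\ forall d, h b d <o b, xi <=o h b (wt b xi) & forall d, d <o wt b xi -> h b d <o xi].

(** The list omits the endpoint [xi], so that walks meeting at a point concatenate without repeating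
    it. *)
Inductive walk (xi : L) : L -> seq L -> Prop :=
| walk_nil : walk xi xi [::]
| walk_cons b l : xi <o b -> walk xi (h b (wt b xi)) l -> walk xi b (b :: l).

Lemma walk_ex xi b : xi <=o b -> exists l, walk xi b l.
Proof.
elim/(@clt_ind L): b => b IH /cle_eqVlt [<-|xb]; first by exists [::]; constructor.
have [hb xh _] := hwtP xb; have [l lP] := IH _ (hb _) xh.
by exists (b :: l); constructor.
Qed.

Lemma walk_uniq xi b l l' : walk xi b l -> walk xi b l' -> l = l'.
Proof.
move=> W; elim: W l' => {b l} [|b l xb _ IH] l' W'.
  by inversion W' as [|b l xb W]; subst=> //; case: (clt_irr xb).
inversion W' as [bE|b' l1 xb' W]; subst; first by case: (clt_irr xb).
by rewrite (IH _ W).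
Qed.

Lemma walk_head xi b l : xi <o b -> walk xi b l -> exists l', l = b :: l'.
Proof.
move=> xb W; inversion W as [bE|b' l1 xb' W']; subst; first by case: (clt_irr xb).
by exists l1.
Qed.

Definition cofK (m : L) : Prop := exists s : K -> L, ladder m s.

(* Fewer than [K] values [h b d] are rejected at a step towards [m]; they all lie below
   [m], so they are bounded below [m]. *)
Lemma walk_pass m eta l : cofK m -> walk m eta l -> exists o, o <o m /\
  forall xi, o <o xi -> xi <o m -> (forall b, List.In b l -> wt b xi = wt b m) /\
    forall l', walk xi m l' -> walk xi eta (l ++ l').
Proof.
move=> [s slad] W; have [sm _ _] := slad.
elim: W => {eta l} [|b l mb _ [o [om IH]]].
  by have [k0] := regular_point Kreg; exists (s k0); split.
have [hb mh wtm] := hwtP mb.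
have [k kP] := ladder_bound (h := fun d : below (wt b m) => h b (sval d)) Kreg
  (@below_small K (wt b m)) slad (fun d => wtm _ (svalP d)).
exists (cmax o (s k)); split; first exact: cmax_lt.
move=> xi oxi xim.
have oxi' : o <o xi by apply: cle_lt_trans oxi; exact: cmaxl.
have kxi : s k <o xi by apply: cle_lt_trans oxi; exact: cmaxr.
have xb := clt_trans xim mb; have [_ xh wtxi] := hwtP xb.
(* The value accepted for [m] is too large to be rejected for [xi], and the values rejected for [m]
   lie below [s k], hence are rejected for [xi] too. *)
have wE : wt b xi = wt b m.
  apply: cle_anti; rewrite cleNgt; apply/negP => lt.
    by apply: (clt_asym (wtxi _ lt)); exact: clt_le_trans xim mh.
  apply: (cle_ltF xh); apply: clt_trans kxi; exact: (kP (pred_below lt)).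
have [IH1 IH2] := IH xi oxi' xim; split=> [c [<-|/IH1]|l' W] //.
by constructor=> //; rewrite wE; exact: IH2.
Qed.

Lemma wt_large m t : cofK m -> exists o, o <o m /\
  forall xi, o <o xi -> xi <o m -> t <=o wt m xi.
Proof.
move=> [s slad]; have [sm _ _] := slad; have [k0] := regular_point Kreg.
have [hm _ _] := hwtP (sm k0).
have [k kP] := ladder_bound (h := fun d : below t => h m (sval d)) Kreg
  (@below_small K t) slad (fun d => hm _).
exists (s k); split=> // xi kxi xim; rewrite cleNgt; apply/negP => lt.
have [_ xh _] := hwtP xim; apply: (cle_ltF xh); apply: clt_trans kxi.
exact: (kP (pred_below lt)).
Qed.

End Walk.

(** * Locating a step of a walk *)

Lemma cat_eq_cat (T : Type) (s1 s2 t1 t2 : seq T) : s1 ++ s2 = t1 ++ t2 ->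
  (exists r, t1 = s1 ++ r /\ s2 = r ++ t2) \/
  (exists x r, s1 = t1 ++ x :: r /\ t2 = x :: r ++ s2).
Proof.
elim: s1 t1 => [|x s1 IH] [|y t1] /=.
- by move=> ->; left; exists [::].
- by move=> ->; left; exists (y :: t1).
- by move=> <-; right; exists x, s1.
- move=> [-> /IH [[r [-> ->]]|[z [r [-> ->]]]]]; first by left; exists r.
  by right; exists z, r.
Qed.

Lemma in_rcons_cat (T : Type) (p x : T) (s t r : seq T) :
  rcons s p = t ++ x :: r -> List.In p (x :: r).
Proof.
elim: t s => [|y t IH] [|z s] /=.
- by case=> -> _; left.
- move=> [_ <-]; right; elim: s => [|u s IHs] /=; [by left | by right].
- by case: t {IH}.
- by case=> _ /IH.
Qed.

Lemma last_split (T : Type) (Q : T -> Prop) (s : seq T) : (exists2 x, List.In x s & Q x) ->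
  exists s1 p s2, [/\ s = rcons s1 p ++ s2, Q p & forall q, List.In q s2 -> ~ Q q].
Proof.
elim: s => [[] //|y s IH] [x xs Qx].
case: (pselect (exists2 z, List.In z s & Q z)) => [/IH [s1 [p [s2 [-> Qp nQ]]]]|nz].
  by exists (y :: s1), p, s2.
exists [::], y, s; split=> //; last by move=> q qs Qq; apply: nz; exists q.
by case: xs => [->//|xs]; case: nz; exists x.
Qed.

Section Locate.
Context {th tp P : cardinal} {V : Type}.
Context (e : tp -> tp -> th) (a : P -> th -> P) (G : P -> P -> th).
Context (l1 : V -> tp) (l2 : V -> P).

Definition lab1 (l : seq V) (u : tp) : Prop := exists2 x, List.In x l & l1 x = u.

Definition max_pair (l : seq V) (u y : tp) : Prop :=
  [/\ lab1 l u, lab1 l y, y <o u &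
      forall u' y', lab1 l u' -> lab1 l y' -> y' <o u' -> e u' y' <=o e u y].

(** Recognizes from the maximal pair alone the labels on the side of [u]: their value with [y] is
    large and that with [u] small; on the side of [y] it is the reverse. *)
Definition upper (u y v : tp) : Prop := y <o v /\ (v <o u -> e u v <o e v y).

Definition valid (w : V -> P) (s : seq V) (p : V) : Prop :=
  ladder (l2 p) (a (l2 p)) /\ forall q, List.In q s -> w q <o l2 p.

(* [s1 := r ++ x :: r'] ends at the last step with an upper [l1]-label, and [x] is
   the first step of [s1] at which the weight has maximal index in the ladder of some
   valid [l2]-label occurring after [s1]. *)
Definition located (w : V -> P) (l : seq V) (x : V) : Prop :=
  exists u y r r' s2, let s1 := r ++ x :: r' in
  [/\ l = s1 ++ s2, max_pair l u y,
      exists s p, s1 = rcons s p /\ upper u y (l1 p),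
      forall p, List.In p s2 -> ~ upper u y (l1 p) &
      exists p, [/\ List.In p s2, valid w s1 p,
        forall q p', List.In q s1 -> List.In p' s2 -> valid w s1 p' ->
          G (l2 p') (w q) <=o G (l2 p) (w x) &
        forall q p', List.In q r -> List.In p' s2 -> valid w s1 p' ->
          G (l2 p') (w q) <o G (l2 p) (w x)]].

Hypothesis GP : forall z v, ladder z (a z) -> v <o z ->
  v <o a z (G z v) /\ forall k, v <o a z k -> G z v <=o k.

Lemma G_mono z v v' : ladder z (a z) -> v <=o v' -> v' <o z -> G z v <=o G z v'.
Proof.
move=> lz vv' vz'; have vz := cle_lt_trans vv' vz'.
apply: (GP lz vz).2; apply: cle_lt_trans vv' _; exact: (GP lz vz').1.
Qed.

Context (w : V -> P) (r0 r1 bot : seq V) (g tau : V).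
Let top := r0 ++ g :: r1.
Let l := top ++ bot.
Context (b : th).
Hypothesis bot_lt : forall q, List.In q bot -> l1 q <o l1 g.
Hypothesis tau_bot : List.In tau bot.
Hypothesis sep : forall u v, lab1 l u -> lab1 l v -> v <o u ->
  (l1 g <=o u -> l1 tau <=o v -> v <o l1 g -> b <o e u v) /\
  (~ [/\ l1 g <=o u, l1 tau <=o v & v <o l1 g] -> e u v <=o b).

Let g_in : List.In g l.
Proof. by rewrite /l /top !in_cat; left; right; left. Qed.

Let tau_in : List.In tau l.
Proof. by rewrite /l in_cat; right. Qed.

Let lab_g : lab1 l (l1 g). Proof. by exists g. Qed.
Let lab_tau : lab1 l (l1 tau). Proof. by exists tau. Qed.

(** The labels of [g] and [tau] already give a value above [b], which pairs outside the zone cannot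
    exceed. *)
Let max_zone u y : max_pair l u y -> [/\ l1 g <=o u, l1 tau <=o y & y <o l1 g].
Proof.
move=> [lu ly yu umax]; apply: contrapT => nz.
have tg := bot_lt tau_bot.
have [tlt _] := sep lab_g lab_tau tg.
have := tlt (cle_refl _) (cle_refl _) tg; apply/negP; rewrite -cleNgt.
exact: cle_trans (umax _ _ lab_g lab_tau tg) ((sep lu ly yu).2 nz).
Qed.

(** For [v] between [y] and [u] exactly one of [(u, v)] and [(v, y)] is in the zone where [e]
    exceeds [b]: the first if [v <o l1 g], the second otherwise. *)
Let upperP u y v : max_pair l u y -> lab1 l v -> (upper u y v <-> l1 g <=o v).
Proof.
move=> uy lv; have [gu ty yg] := max_zone uy; have [lu ly yu _] := uy; split.
  move=> [yv uv]; rewrite cleNgt; apply/negP => vg.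
  have vu := clt_le_trans vg gu; apply: (clt_asym (uv vu)).
  have tv := cle_trans ty (cltW yv).
  apply: cle_lt_trans ((sep lu lv vu).1 gu tv vg).
  by apply: (sep lv ly yv).2 => -[gv _ _]; exact: (cle_ltF gv).
move=> gv; have yv := clt_le_trans yg gv; split=> // vu.
apply: (cle_lt_trans (y := b)); last exact: (sep lv ly yv).1.
by apply: (sep lu lv vu).2 => -[_ _]; exact: (cle_ltF gv).
Qed.

Let max_ex : exists u y, max_pair l u y.
Proof.
have tg := bot_lt tau_bot.
have [|[u y] [uy yu umax]] := @seq_max th (tp * tp) (fun p => e p.1 p.2)
    (fun p => p.2 <o p.1) (List.list_prod (map l1 l) (map l1 l)).
  exists (l1 g, l1 tau) => //; apply/List.in_prod_iff.
  by split; apply/List.in_map_iff; [exists g | exists tau].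
exists u, y; move/List.in_prod_iff: uy => [/List.in_map_iff [x [xu xl]] /List.in_map_iff [x' [xy xl']]].
split=> //; [by exists x | by exists x' |].
move=> u' y' [v vl vu] [v' vl' vy] y'u'; apply: (umax (u', y')) => //.
by apply/List.in_prod_iff; split; apply/List.in_map_iff; [exists v | exists v'].
Qed.

Context (k : th) (eps : P).
Hypothesis tau_lad : ladder (l2 tau) (a (l2 tau)).
Hypothesis top_lt : forall q, List.In q top -> w q <o l2 tau.
Hypothesis r0_eps : forall q, List.In q r0 -> w q <=o eps.
Hypothesis eps_g : eps <=o w g.
Hypothesis top_G : forall q p, List.In q top -> List.In p top ->
  ladder (l2 p) (a (l2 p)) -> w q <o l2 p -> G (l2 p) (w q) <=o k.
Hypothesis g_G : k <o G (l2 tau) (w g).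
Hypothesis bot_G : forall q p, List.In q top -> List.In p bot ->
  ladder (l2 p) (a (l2 p)) -> w g <o l2 p -> w q <o l2 p -> G (l2 p) (w q) <=o G (l2 p) (w g).
Hypothesis eps_G : forall p, List.In p bot ->
  ladder (l2 p) (a (l2 p)) -> w g <o l2 p -> G (l2 p) eps <=o k.

Let split_g s p s2 : l = rcons s p ++ s2 -> l1 g <=o l1 p ->
    (forall q, List.In q s2 -> ~ l1 g <=o l1 q) ->
  exists q1 r2, [/\ rcons s p = r0 ++ g :: q1, top = rcons s p ++ r2 & s2 = r2 ++ bot].
Proof.
move=> /esym /cat_eq_cat [[r2 [topE s2E]]|[x [r [sE bE]]]] gp ns2; last first.
  have pin := in_rcons_cat sE.
  case: (cle_ltF gp); apply: bot_lt; rewrite bE -cat_cons in_cat; by left.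
case: (cat_eq_cat (esym topE)) => [[r3 [r0E gE]]|[x [q1 [sE gE]]]].
  case: (ns2 g); last exact: cle_refl.
  by rewrite s2E in_cat; left; rewrite gE in_cat; right; left.
by case: gE => gx gE; exists q1, r2; split=> //; rewrite sE -gx.
Qed.

Let r0_top q : List.In q r0 -> List.In q top.
Proof. by rewrite /top in_cat; left. Qed.

Section Values.
Variables (s1 r2 q1 : seq V).
Hypothesis s1E : s1 = r0 ++ g :: q1.
Hypothesis topE : top = s1 ++ r2.

Let s1_top q : List.In q s1 -> List.In q top.
Proof. by rewrite topE in_cat; left. Qed.

Let g_s1 : List.In g s1.
Proof. by rewrite s1E in_cat; right; left. Qed.

Let tau_valid : valid w s1 tau.
Proof. by split=> // q /s1_top /top_lt. Qed.

Let value_r0 q p : List.In q r0 -> List.In p (r2 ++ bot) -> valid w s1 p ->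
  G (l2 p) (w q) <=o k.
Proof.
move=> qr0; rewrite in_cat => -[pr2|pb] [lp ws].
  apply: top_G => //; first exact: r0_top.
    by rewrite topE in_cat; right.
  by apply: ws; rewrite s1E in_cat; left.
have gp := ws _ g_s1; apply: cle_trans (eps_G pb lp gp).
by apply: G_mono => //; [exact: r0_eps | exact: cle_lt_trans gp].
Qed.

Let value_s1 q p : List.In q s1 -> List.In p (r2 ++ bot) -> valid w s1 p ->
  G (l2 p) (w q) <=o k \/ G (l2 p) (w q) <=o G (l2 p) (w g).
Proof.
move=> qs; rewrite in_cat => -[pr2|pb] [lp ws].
  left; apply: top_G => //; [exact: s1_top | by rewrite topE in_cat; right | exact: ws].
by right; apply: bot_G => //; [exact: s1_top | exact: ws | exact: ws].
Qed.

(** Take a valid label maximizing the index of [w g]: this index exceeds [k] because [tau] competes,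
    and every other index is at most [k] or at most an index of [w g]. *)
Lemma located_value_ex : exists p, [/\ List.In p (r2 ++ bot), valid w s1 p,
  forall q p', List.In q s1 -> List.In p' (r2 ++ bot) -> valid w s1 p' ->
    G (l2 p') (w q) <=o G (l2 p) (w g) &
  forall q p', List.In q r0 -> List.In p' (r2 ++ bot) -> valid w s1 p' ->
    G (l2 p') (w q) <o G (l2 p) (w g)].
Proof.
have tau_s2 : List.In tau (r2 ++ bot) by rewrite in_cat; right.
have [|p [ps vp pmax]] := @seq_max th V (fun p => G (l2 p) (w g)) (valid w s1) (r2 ++ bot).
  by exists tau.
have kp : k <o G (l2 p) (w g) by exact: clt_le_trans g_G (pmax _ tau_s2 tau_valid).
exists p; split=> // q p' qs ps' vp'.
  case: (value_s1 qs ps' vp') => [qk|qg]; last exact: cle_trans qg (pmax _ ps' vp').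
  exact: cltW (cle_lt_trans qk kp).
exact: cle_lt_trans (value_r0 qs ps' vp') kp.
Qed.

(** Competing with [g] and [tau] forces the index at [x] above [k], so [x] is not before [g]; if [g]
    came before [x], strictness would contradict [value_s1]. *)
Lemma located_value_uniq r x r' p : s1 = r ++ x :: r' ->
  List.In p (r2 ++ bot) -> valid w s1 p ->
  (forall q p', List.In q s1 -> List.In p' (r2 ++ bot) -> valid w s1 p' ->
    G (l2 p') (w q) <=o G (l2 p) (w x)) ->
  (forall q p', List.In q r -> List.In p' (r2 ++ bot) -> valid w s1 p' ->
    G (l2 p') (w q) <o G (l2 p) (w x)) -> x = g.
Proof.
move=> s1E' ps vp pmax pstrict.
have tau_s2 : List.In tau (r2 ++ bot) by rewrite in_cat; right.
have kx : k <o G (l2 p) (w x).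
  exact: clt_le_trans g_G (pmax _ _ g_s1 tau_s2 tau_valid).
have := s1E; rewrite s1E' => /cat_eq_cat [[[|y r3] /= [r0E xE]]|[y [r3 [rE gE]]]].
- by case: xE.
- case: xE => xy _; case: (cle_ltF _ kx); apply: value_r0 => //.
  by rewrite r0E in_cat xy; right; left.
- case: gE => gy _.
  have gr : List.In g r by rewrite rE in_cat gy; right; left.
  have xs : List.In x s1 by rewrite s1E' in_cat; right; left.
  case: (value_s1 xs ps vp) => [/cle_ltF //|le].
  by case: (cle_ltF le); exact: pstrict.
Qed.

End Values.

Lemma locatedP x : located w l x <-> x = g.
Proof.
split.
  move=> [u [y [r [r' [s2 [lE uy [s [p [sE pU]]] nU [p' [ps vp pmax pstrict]]]]]]]].
  have lP q : List.In q l -> lab1 l (l1 q) by move=> ql; exists q.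
  have p_in : List.In p l.
    rewrite lE in_cat sE; left; elim: (s) => [|z s' IH] /=; [by left | by right].
  have lE' : l = rcons s p ++ s2 by rewrite -sE.
  have gp := (upperP uy (lP _ p_in)).1 pU.
  have ns2 q : List.In q s2 -> ~ l1 g <=o l1 q.
    move=> qs gq; apply: (nU q qs); apply: (upperP uy _).2 gq; apply: lP.
    by rewrite lE in_cat; right.
  have [q1 [r2 [sg topE s2E]]] := split_g lE' gp ns2.
  rewrite -sE in sg topE; rewrite s2E in ps pmax pstrict.
  exact: (located_value_uniq sg topE _ ps vp pmax pstrict).
move=> ->.
have [|s [p [s2 [topE gp ns2]]]] := @last_split V (fun q => l1 g <=o l1 q) l.
  by exists g => //; exact: cle_refl.
have [q1 [r2 [sg tE s2E]]] := split_g topE gp ns2.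
have [u [y uy]] := max_ex.
have lP q : List.In q l -> lab1 l (l1 q) by move=> ql; exists q.
have p_in : List.In p l.
  rewrite topE in_cat; left; elim: (s) => [|z s' IH] /=; [by left | by right].
exists u, y, r0, q1, s2; split=> //.
- by rewrite -sg.
- by exists s, p; split=> //; exact: ((upperP uy (lP _ p_in)).2 gp).
- move=> q qs Uq; apply: (ns2 q qs); apply: (upperP uy _).1 Uq; apply: lP.
  by rewrite topE in_cat; right.
- rewrite -sg s2E; have := located_value_ex sg tE.
  by rewrite sg.
Qed.

End Locate.

(** * The coloring *)

(** By injectivity each ordinal occurs in the row of at most one [al], so the [al] whose row meets
    the ordinals up to [x] are bounded. *)
Lemma unbounded_escape (L : cardinal) (T : Type) (z : L -> T -> L) (x : L) : regular L ->
  injective (fun p : L * T => z p.1 p.2) -> exists al, x <o al /\ forall t, x <o z al t.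
Proof.
move=> Lreg zi.
have Hf (y : L) : exists b, forall al t, z al t = y -> al <o b.
  case: (pselect (exists al t, z al t = y)) => [[al [t zy]]|n]; last first.
    by exists y => al t zy; case: n; exists al, t.
  have [b alb] := (regular_breg Lreg).1 al; exists b => al' t' zy'.
  by have /zi [-> _] : z (al', t').1 (al', t').2 = z (al, t).1 (al, t).2 by rewrite zy.
have [f fP] := choice Hf; have [b bP] := bound_le f x Lreg.
have [al mal] := (regular_breg Lreg).1 (cmax x b).
exists al; split; first exact: cle_lt_trans (cmaxl _ _) mal.
move=> t; rewrite cltNge; apply/negP => /bP; apply/negP; rewrite -cleNgt.
apply: cle_trans (cltW (fP _ al t erefl)).
exact: cltW (cle_lt_trans (cmaxr _ _) mal).
Qed.

Lemma bounded_in_seqs (th : cardinal) (X T V : Type) (f : V -> X) (s : T -> seq V) :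
  regular th -> ~ embeds th T ->
  bounded_in th (fun u => exists t, exists2 x, List.In x (s t) & f x = u).
Proof.
move=> threg thT F; have [k0] := regular_point threg.
have [g gP] := choice (fun t => seq_bound k0 (fun x => F (f x)) (s t)).
have [b bP] := regular_bounds threg thT g; exists b => _ [t [x xs <-]].
exact: cle_lt_trans (gP t x xs) (bP t).
Qed.

Section Main.
Context {P th tp L : cardinal} (Preg : regular P) (threg : regular th).
Context (tpS : is_succ th tp) (tpP : card_lt tp P) (LS : is_succ P L).

Let tpreg : regular tp. Proof. exact: succ_regular tpS. Qed.
Let Lreg : regular L. Proof. exact: succ_regular LS. Qed.
Let Ptp : ~ embeds P tp. Proof. by move=> /cardT_le_embeds; exact: tpP.2. Qed.
Let tpth : ~ embeds tp th. Proof. by move=> /cardT_le_embeds; exact: tpS.1.2. Qed.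
Let thtp : embeds th tp. Proof. by apply/cardT_le_embeds; exact: tpS.1.1. Qed.
Let LP : ~ embeds L P. Proof. by move=> /cardT_le_embeds; exact: LS.1.2. Qed.
Let tp_P : embeds tp P. Proof. by apply/cardT_le_embeds; exact: tpP.1. Qed.
Let Ltp : ~ embeds L tp. Proof. by move=> E; apply: LP; exact: (embeds_trans E tp_P). Qed.
Let Pth : ~ embeds P th. Proof. by move=> E; apply: Ptp; exact: (embeds_trans E thtp). Qed.

Let small_tp T : ~ embeds th T -> ~ embeds tp T.
Proof. by move=> n E; apply: n; exact: (embeds_trans thtp E). Qed.
Let small_P T : ~ embeds th T -> ~ embeds P T.
Proof. by move=> /small_tp n E; apply: n; exact: (embeds_trans tp_P E). Qed.
Let small_L T : ~ embeds th T -> ~ embeds L T.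
Proof.
move=> /small_P n E; apply: n; apply: embeds_trans E.
by apply/cardT_le_embeds; exact: LS.1.1.
Qed.

Context (e : tp -> tp -> th) (a : P -> th -> P) (G : P -> P -> th).
Context (h : L -> P -> L) (wt : L -> L -> P) (col : L -> L) (l1 : L -> tp) (l2 : L -> P).
Hypothesis e_inj : forall x y z, y <o x -> z <o x -> e x y = e x z -> y = z.
Hypothesis a_guess : forall F : P -> P,
  exists z, ladder z (a z) /\ forall k, closed_under F (a z k).
Hypothesis GP : forall z v, ladder z (a z) -> v <o z ->
  v <o a z (G z v) /\ forall k, v <o a z k -> G z v <=o k.
Hypothesis hwtP : forall b xi, xi <o b ->
  [/\ forall d, h b d <o b, xi <=o h b (wt b xi) & forall d, d <o wt b xi -> h b d <o xi].
Hypothesis labP : forall g i z,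
  stat (fun x => @cofK P L x /\ [/\ col x = g, l1 x = i & l2 x = z]).

Context (T0 T1 : Type) (T0s : ~ embeds th T0) (T1s : ~ embeds th T1).
Context (z0 : L -> T0 -> L) (z1 : L -> T1 -> L).
Hypothesis z0_inj : injective (fun p : L * T0 => z0 p.1 p.2).
Hypothesis z1_inj : injective (fun p : L * T1 => z1 p.1 p.2).
Context (g0 : L).

(** [eps] and [o] are fixed before [t], so the weight at [ga] can be raised without raising those
    before it. They, and then [m0], are made constant on stationary sets of candidates [ga]. *)
Lemma top_ex (j : tp) : exists (eps : P) (o : L), forall t : P, exists m0 : L, forall x : L,
  exists ga al : L, [/\ [/\ x <o ga, ga <o al, col ga = g0 & l1 ga = j],
    forall m, m0 <o m -> m <o ga -> t <=o wt ga m, forall y, ga <o z1 al y &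
    forall y, exists l, [/\ walk h wt ga (z1 al y) l, forall q, List.In q l -> wt q ga <=o eps &
      forall xi, o <o xi -> xi <o ga -> (forall q, List.In q l -> wt q xi = wt q ga) /\
        forall l', walk h wt xi ga l' -> walk h wt xi (z1 al y) (l ++ l')]].
Proof.
have [p0] := regular_point Preg.
pose Q (ga : L) (eps : P) (o : L) := o <o ga /\ exists al, [/\ ga <o al, forall y, ga <o z1 al y &
    forall y, exists l, [/\ walk h wt ga (z1 al y) l, forall q, List.In q l -> wt q ga <=o eps &
      forall xi, o <o xi -> xi <o ga -> (forall q, List.In q l -> wt q xi = wt q ga) /\
        forall l', walk h wt xi ga l' -> walk h wt xi (z1 al y) (l ++ l')]].
have Qex (ga : L) : @cofK P L ga -> exists eps o, Q ga eps o.
  move=> gaS; have [al [gal gaz]] := unbounded_escape ga Lreg z1_inj.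
  have [l lP] := choice (fun y => walk_ex hwtP (cltW (gaz y))).
  have [o oP] := choice (fun y => walk_pass Preg hwtP gaS (lP y)).
  have [s slad] := gaS; have [sga _ _] := slad.
  have [k kP] := ladder_bound Preg (small_P T1s) slad (fun y => (oP y).1).
  have [eps epsP] := choice (fun y => seq_bound p0 (fun q => wt q ga) (l y)).
  have [ep epP] := regular_bounds Preg (small_P T1s) eps.
  exists ep, (s k); split=> //; exists al; split=> // y; exists (l y); split=> //.
    by move=> q /epsP qe; apply: cltW; exact: cle_lt_trans qe (epP y).
  by move=> xi kxi; apply: (oP y).2; exact: clt_trans kxi.
have [eps epsP] := @stat_split L P _ (fun ga eps => exists o, Q ga eps o) Lreg LP
  (labP g0 j p0) (fun ga H => Qex ga H.1).
have Hr (ga : L) : exists o, (exists o', Q ga eps o') -> Q ga eps o.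
  case: (pselect (exists o', Q ga eps o')) => [[o Qo]|n]; first by exists o.
  by exists ga.
have [r rP] := choice Hr.
have [o oP] := fodor Lreg epsP (fun ga H => (rP ga H.2).1).
exists eps, o => t.
have Hm (ga : L) : exists m0, @cofK P L ga -> m0 <o ga /\
    forall m, m0 <o m -> m <o ga -> t <=o wt ga m.
  case: (pselect (@cofK P L ga)) => [gaS|n]; last by exists ga.
  by have [m0 m0P] := wt_large Preg hwtP t gaS; exists m0.
have [mm mmP] := choice Hm.
have [m0 m0P] := fodor Lreg oP (fun ga H => (mmP ga H.1.1.1).1).
exists m0 => x; have [ga [[[[[gaS [gac gaj _]] /rP [_ [al [gal gaz alP]]]] ro] mE] xga _]] := m0P id x.
exists ga, al; split=> //; first by rewrite -mE; exact: (mmP ga gaS).2.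
by move=> y; have [l [W we pl]] := alP y; exists l; rewrite -ro.
Qed.

(* A walk from [z1 (ta D) y] to [m] is [tl D y ++ tg D :: tr D]; below [m] and above
   [tom D] it is an initial part of all walks. [ts D] bounds its weights and [tk D]
   the indices of its weights in the ladders of its labels. *)
Record top_data := TopData {
  tg : L; ta : L; tl : T1 -> seq L; tr : seq L; tom : L; ts : P; tk : th }.

Definition top_list (D : top_data) (y : T1) : seq L := tl D y ++ tg D :: tr D.

Definition is_top (eps : P) (m : L) (j : tp) (t : P) (D : top_data) : Prop :=
  [/\ [/\ m <o tg D, tg D <o ta D, col (tg D) = g0, l1 (tg D) = j & t <=o wt (tg D) m],
      (forall y, m <o z1 (ta D) y) /\ tom D <o m,
      forall xi, tom D <o xi -> xi <o m -> forall y,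
        (forall q, List.In q (top_list D y) -> wt q xi = wt q m) /\
        forall l', walk h wt xi m l' -> walk h wt xi (z1 (ta D) y) (top_list D y ++ l'),
      forall y q, List.In q (tl D y) -> wt q m <=o eps &
      forall y q, List.In q (top_list D y) -> wt q m <o ts D /\
        forall p, List.In p (top_list D y) -> G (l2 p) (wt q m) <=o tk D].

(** The parameters of [top_ex] are bounded over all [j] and [t]. Above the bounds the walk is
    continued from [ga] to [m], and [walk_pass] at [m] leaves the rest free for a bottom. *)
Lemma tops_ex : exists (eps : P) (mstar : L), forall m, mstar <o m -> @cofK P L m ->
  forall j t, exists D, is_top eps m j t D.
Proof.
have [p0] := regular_point Preg; have [k0] := regular_point threg.
have [epsj Hj] := choice top_ex; have [oj {}Hj] := choice Hj.
have [m0 Hm] := choice (fun jt : tp * P => Hj jt.1 jt.2).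
have [eps epsP] := regular_bounds Preg Ptp epsj.
have [mj mjP] := choice (fun j => regular_bounds Lreg LP (fun t => cmax (oj j) (m0 (j, t)))).
have [mstar mstarP] := regular_bounds Lreg Ltp mj.
exists eps, mstar => m mm mS j t.
have omj : cmax (oj j) (m0 (j, t)) <o m.
  exact: clt_trans (clt_trans (mjP j t) (mstarP j)) mm.
have oj_m : oj j <o m by apply: cle_lt_trans omj; exact: cmaxl.
have m0_m : m0 (j, t) <o m by apply: cle_lt_trans omj; exact: cmaxr.
have [ga [al [[mga gal gac gaj] gat gaz alP]]] := Hm (j, t) m.
have [l lP] := choice alP.
have [l0 Wl0] := walk_ex hwtP (cltW mga).
have [r1 l0E] := walk_head mga Wl0.
have W y : walk h wt m (z1 al y) (l y ++ ga :: r1).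
  by rewrite -l0E; have [_ _ pl] := lP y; apply: (pl m oj_m mga).2.
have [o oP] := choice (fun y => walk_pass Preg hwtP mS (W y)).
have [s slad] := mS; have [sm _ _] := slad.
have [k kP] := ladder_bound Preg (small_P T1s) slad (fun y => (oP y).1).
have [w wP] := choice (fun y => seq_bound p0 (fun q => wt q m) (l y ++ ga :: r1)).
have [ws wsP] := regular_bounds Preg (small_P T1s) w.
have [v vP] := choice (fun y => seq_bound k0 (fun qp : L * L => G (l2 qp.2) (wt qp.1 m))
  (List.list_prod (l y ++ ga :: r1) (l y ++ ga :: r1))).
have [vs vsP] := regular_bounds threg T1s v.
exists (TopData ga al l r1 (s k) ws vs); split=> //=.
- by split=> //; exact: gat.
- by split=> // y; exact: clt_trans mga (gaz y).
- by move=> xi kxi xim y; apply: (oP y).2 => //; exact: clt_trans kxi.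
- move=> y q ql; have [_ we pl] := lP y.
  rewrite (pl m oj_m mga).1 //; apply: cle_trans (we q ql) _; exact: cltW.
- move=> y q ql; split; first exact: cle_lt_trans (wP y q ql) (wsP y).
  move=> p pl; apply: cltW; apply: cle_lt_trans (vsP y).
  by apply: (vP y (q, p)); apply/List.in_prod_iff.
Qed.

(** A label [z'] other than [z] cannot tell apart weights from [a z k] up to [z]: either [z'] is
    below them all, or its ladder has no rung among them. The first clause keeps the index of [eps]
    low. *)
Definition bot_ok (eps z : P) (k : th) (z' : P) : Prop := ladder z' (a z') ->
  [/\ eps <o z' -> G z' eps <=o k, z' <o z -> z' <o a z k &
      z <o z' -> forall k', a z' k' <o z -> a z' k' <o a z k].

Lemma bot_ok_mono eps z k k' z' : ladder z (a z) -> k <=o k' ->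
  bot_ok eps z k z' -> bot_ok eps z k' z'.
Proof.
move=> [_ amono _] kk' ok /ok [H1 H2 H3]; split.
- by move=> /H1; move/cle_trans; apply.
- by move=> /H2 lt; apply: clt_le_trans lt (amono _ _ kk').
- by move=> /H3 H k'' /H lt; apply: clt_le_trans lt (amono _ _ kk').
Qed.

Lemma bot_ok_ex eps z z' : ladder z (a z) -> exists k, bot_ok eps z k z'.
Proof.
move=> zl; have [k0] := regular_point threg.
case: (pselect (ladder z' (a z'))) => [zl'|n]; last by exists k0.
have [az amono acof] := zl; have [az' amono' acof'] := zl'.
case: (clt_trich z' z) => [zz'|zz'|zz'].
- have [k zk] := acof _ zz'; exists (cmax (G z' eps) k) => _; split.
  + by move=> _; exact: cmaxl.
  + by move=> _; apply: clt_le_trans zk _; apply: amono; exact: cmaxr.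
  + by move=> /(clt_asym zz').
- exists (G z' eps) => _; rewrite zz'; split=> [_|/clt_irr|/clt_irr] //; exact: cle_refl.
(* Fewer than [th] rungs of [z'] lie below [z], so some rung of [z] exceeds them all. *)
have [ks zks] := acof' _ zz'.
have Hh (k' : below ks) : exists v, v <o z /\ (a z' (sval k') <o z -> v = a z' (sval k')).
  case: (cltP (a z' (sval k')) z) => [lt|ge]; first by exists (a z' (sval k')).
  by exists (a z k0); split=> // /(cle_ltF ge).
have [v vP] := choice Hh.
have [k kP] := ladder_bound threg (@below_small th ks) zl (fun k' => (vP k').1).
exists (cmax (G z' eps) k) => _; split.
- by move=> _; exact: cmaxl.
- by move=> /(clt_asym zz').
- move=> _ k' k'z.
  have k'ks : k' <o ks.
    rewrite cltNge; apply/negP => /amono' le; apply: (clt_asym k'z).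
    exact: clt_le_trans zks le.
  apply: clt_le_trans (amono _ _ (cmaxr (G z' eps) k)).
  by rewrite -((vP (pred_below k'ks)).2 k'z); exact: kP.
Qed.

(** The order of choices is: [m], the tops at [m], the label [z] guessing bounds on these tops, the
    bottoms through a point labelled [z], the index [k], which sets the required weight [t0], and
    last [j] and [i]. *)
Theorem monochromatic_rectangle : exists al0 al1 : L, al0 <o al1 /\ forall (x : T0) (y : T1),
  z0 al0 x <o z1 al1 y /\ exists l ga, [/\ walk h wt (z0 al0 x) (z1 al1 y) l, col ga = g0 &
    forall q, located e a G l1 l2 (fun b => wt b (z0 al0 x)) l q <-> q = ga].
Proof.
have [p0] := regular_point Preg; have [k0] := regular_point threg.
have [eps [mstar topP]] := tops_ex.
have [A0 A0P] := choice (fun o => unbounded_escape o Lreg z0_inj).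
(* [B0 o] bounds a whole row of [z0] above [o], so a point closed under [B0] has such rows below it,
   arbitrarily high. *)
have HB (o : L) : exists b, A0 o <o b /\ forall x, z0 (A0 o) x <o b.
  have [b bP] := regular_bounds Lreg (small_L T0s) (z0 (A0 o)).
  have [c cP] := (regular_breg Lreg).1 (cmax (A0 o) b).
  exists c; split; first exact: cle_lt_trans (cmaxl _ _) cP.
  by move=> x; apply: clt_trans (bP x) _; exact: cle_lt_trans (cmaxr _ _) cP.
have [B0 B0P] := choice HB.
have HT (p : tp * P * L) : exists ta, [/\ @cofK P L ta, l1 ta = p.1.1, l2 ta = p.1.2,
    closed_under B0 ta & p.2 <o ta].
  have [ta [[taS [_ t1 t2]] ot tB]] := labP g0 p.1.1 p.1.2 B0 p.2.
  by exists ta.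
have [tau tauP] := choice HT.
have [F1 F1P] := choice (fun io : tp * L =>
  regular_bounds Lreg LP (fun z => tau (io.1, z, io.2))).
have [F2 F2P] := choice (fun o => regular_bounds Lreg Ltp (fun i => F1 (i, o))).
have [m [s [mm mF slad]]] := ladder_closed F2 mstar Preg Lreg LP.
have mS : @cofK P L m by exists s.
have [D DP] := choice (fun jt : tp * P => topP m mm mS jt.1 jt.2).
(* Since [th] is smaller than [P], for each [j] some index bound recurs for cofinally many [t]; [nx]
   selects such a [t]. *)
have Hk (j : tp) : exists k, forall t, exists t', t <=o t' /\ tk (D (j, t')) = k.
  apply: contrapT => nk.
  have Ht (k : th) : exists t, forall t', t <=o t' -> tk (D (j, t')) <> k.
    apply: contrapT => nt; apply: nk; exists k => t; apply: contrapT => nt'; apply: nt.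
    by exists t => t' tt' E; apply: nt'; exists t'.
  have [f fP] := choice Ht; have [t tP] := regular_bounds Preg Pth f.
  exact: (fP _ t (cltW (tP (tk (D (j, t)))))).
have [kj kjP] := choice Hk.
have [nx nxP] := choice (fun jt : tp * P => kjP jt.1 jt.2).
(* A rung closed under [F3] exceeds, for all [j] and all [t] below it, the weights of the selected
   top. *)
have [F3 F3P] := choice (fun t => regular_bounds Preg Ptp
  (fun j => cmax (cmax (nx (j, t)) (ts (D (j, nx (j, t))))) eps)).
have [z [zl zF]] := a_guess F3.
have [az amono acof] := zl.
(* Only the tops with parameter below [z] are considered, fewer than [P], so one rung of [m] is
   above all their [tom]. *)
have [oz0 ozP] : exists k, forall p : tp * below z, tom (D (p.1, sval p.2)) <o s k.
  apply: (ladder_bound Preg (small_prod Preg Ptp (@below_small P z)) slad).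
  by move=> p; have [_ []] := DP (p.1, sval p.2).
have [sm _ _] := slad.
(* A row of [z0] is placed above [s oz0] and so close below a point with labels [i] and [z] that the
   walks from [m] pass through that point. *)
have HBot (i : tp) : exists q : L * L * (T0 -> seq L), [/\ q.1.2 <o m, l1 q.1.1 = i,
    l2 q.1.1 = z, (forall x, s oz0 <o z0 q.1.2 x /\ z0 q.1.2 x <o m) &
    forall x, walk h wt (z0 q.1.2 x) m (q.2 x) /\ List.In q.1.1 (q.2 x)].
  have [taS t1 t2 tB ot] := tauP (i, z, s oz0).
  have tam : tau (i, z, s oz0) <o m.
    apply: clt_trans (mF _ (sm oz0)); apply: clt_trans (F2P _ i).
    exact: (F1P (i, s oz0)).
  set ta := tau _ in taS t1 t2 tB ot tam.
  have [lb lbP] := walk_ex hwtP (cltW tam).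
  have [o [ota oP]] := walk_pass Preg hwtP taS lbP.
  have o'ta := cmax_lt ota ot.
  have [BA Bz] := B0P (cmax o (s oz0)); have BT := tB _ o'ta.
  have xiP x : [/\ o <o z0 (A0 (cmax o (s oz0))) x, s oz0 <o z0 (A0 (cmax o (s oz0))) x &
      z0 (A0 (cmax o (s oz0))) x <o ta].
    have lo := (A0P (cmax o (s oz0))).2 x; split.
    - by apply: cle_lt_trans lo; exact: cmaxl.
    - by apply: cle_lt_trans lo; exact: cmaxr.
    - exact: clt_trans (Bz x) BT.
  move: (A0 _) BA xiP {Bz} => al0 BA xiP.
  have Hl x : exists l', walk h wt (z0 al0 x) m l' /\ List.In ta l'.
    have [ox _ xt] := xiP x; have [l' W'] := walk_ex hwtP (cltW xt).
    have [l'' l'E] := walk_head xt W'.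
    exists (lb ++ l'); split; first exact: (oP _ ox xt).2.
    by rewrite in_cat l'E; right; left.
  have [l lP] := choice Hl; exists (ta, al0, l); split=> //=.
  - exact: clt_trans (clt_trans BA BT) tam.
  - by move=> x; have [_ ox xt] := xiP x; split=> //; exact: clt_trans xt tam.
have [Bt BtP] := choice HBot.
have [kz kzP] := choice (fun z' => bot_ok_ex eps z' zl).
have Hkb (i : tp) : exists k, forall x q, List.In q ((Bt i).2 x) -> bot_ok eps z k (l2 q).
  have [f fP] := choice (fun x => seq_bound k0 (fun q => kz (l2 q)) ((Bt i).2 x)).
  have [k kP] := regular_bounds threg T0s f; exists k => x q qx.
  by apply: (bot_ok_mono zl _ (kzP (l2 q))); exact: cle_trans (fP x q qx) (cltW (kP x)).
(* [k] must be fixed before [i] and [j], so the bounds depending on them are made constant on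
   stationary sets. *)
have Scof := stat_ladder threg tpreg tpth.
have [k1 I1] := @stat_split tp th _ (fun i k => forall x q, List.In q ((Bt i).2 x) ->
  bot_ok eps z k (l2 q)) tpreg tpth Scof (fun i _ => Hkb i).
have [k2 J2] := @stat_split tp th _ (fun j k => kj j = k) tpreg tpth Scof
  (fun j _ => ex_intro _ _ erefl).
have [k3 epsk3] : exists k3, eps <o a z k3.
  have [k zk] := acof _ (az k0).
  exists k; apply: clt_trans (zF k _ zk).
  have [i0] := regular_point tpreg; apply: cle_lt_trans (F3P _ i0).
  exact: cmaxr.
pose k := cmax (cmax k1 k2) k3.
have k1k : k1 <=o k by exact: cle_trans (cmaxl _ _) (cmaxl _ _).
have k2k : k2 <=o k by exact: cle_trans (cmaxr _ _) (cmaxl _ _).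
have k3k : k3 <=o k by exact: cmaxr.
pose t0 := a z k; pose tj j := nx (j, t0); pose Dj j := D (j, tj j).
pose A j u := exists y, lab1 l1 (top_list (Dj j) y) u.
pose B i u := exists x, lab1 l1 ((Bt i).2 x) u.
have Ath j : bounded_in th (A j) by exact: bounded_in_seqs.
have Bth i : bounded_in th (B i) by exact: bounded_in_seqs.
have Btp i : exists b, forall v, B i v -> v <o b.
  have [i0] := regular_point tpreg.
  have [f fP] := choice (fun x => seq_bound i0 l1 ((Bt i).2 x)).
  have [b bP] := regular_bounds tpreg (small_tp T0s) f; exists b => _ [x [q qx <-]].
  exact: cle_lt_trans (fP x q qx) (bP x).
have [j [i [b [[_ kjk2] [_ iok] Bj sep]]]] := separate_labels threg tpreg tpth e_inj
  Ath Bth Btp J2 I1 (fun j H => H.1) (fun i H => H.1).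
have [[mga gal gac gaj tga] [mz1 tomm] Wtop wl0 wtop] := DP (j, tj j).
rewrite -/(Dj j) in mga gal gac gaj tga mz1 tomm Wtop wl0 wtop.
have [al0m t1 t2 z0m WB] := BtP i.
have t0tj : t0 <=o tj j := (nxP (j, t0)).1.
have F3t0 v : t0 <o v -> (exists k', v = a z k') -> ts (Dj j) <o v /\ tj j <o v.
  move=> t0v [k' vE]; have cl := zF k' t0; rewrite -vE in cl.
  have lt := clt_trans (F3P t0 j) (cl t0v).
  have lt' : cmax (nx (j, t0)) (ts (Dj j)) <o v.
    by apply: cle_lt_trans lt; exact: cmaxl.
  by split; apply: cle_lt_trans lt'; [exact: cmaxr | exact: cmaxl].
have [tsz tjz] : ts (Dj j) <o z /\ tj j <o z.
  have [k' t0k'] := acof _ (az k); have [H1 H2] := F3t0 _ t0k' (ex_intro _ k' erefl).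
  by split; [apply: clt_trans H1 _ | apply: clt_trans H2 _]; exact: az.
exists (Bt i).1.2, (ta (Dj j)); split.
  exact: clt_trans (clt_trans al0m mga) gal.
move=> x y; have [ozx xm] := z0m x; split; first exact: clt_trans xm (mz1 y).
have tomx : tom (Dj j) <o z0 (Bt i).1.2 x.
  by apply: clt_trans (ozP (j, pred_below tjz)) ozx.
set xi := z0 _ x in ozx xm tomx *.
have [wxi Wxi] := Wtop xi tomx xm y.
have [Wb tin] := WB x; rewrite -/xi in Wb.
exists (top_list (Dj j) y ++ (Bt i).2 x), (tg (Dj j)); split=> //; first exact: Wxi.
have g_top : List.In (tg (Dj j)) (top_list (Dj j) y).
  by rewrite /top_list in_cat; right; left.
have wg := wxi _ g_top.
have t0g : t0 <=o wt (tg (Dj j)) m by exact: cle_trans t0tj tga.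
have epsg : eps <o wt (tg (Dj j)) m.
  by apply: clt_le_trans epsk3 _; apply: cle_trans t0g; exact: amono.
have wts q : List.In q (top_list (Dj j) y) -> wt q xi <o ts (Dj j).
  by move=> qt; rewrite wxi //; exact: (wtop y q qt).1.
have botok q : List.In q ((Bt i).2 x) -> bot_ok eps z k (l2 q).
  by move=> /iok; exact: bot_ok_mono.
apply: (@locatedP th tp P L e a G l1 l2 GP _ (tl (Dj j) y) (tr (Dj j)) ((Bt i).2 x)
  (tg (Dj j)) (Bt i).1.1 b _ _ _ k eps) => //.
- by move=> q qx; rewrite gaj; apply: Bj; exists x, q.
- rewrite gaj t1 => u v lu lv vu.
  have cover u' : lab1 l1 (top_list (Dj j) y ++ (Bt i).2 x) u' -> A j u' \/ B i u'.
    move=> [q]; rewrite in_cat => -[qt|qb] qE; first by left; exists y, q.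
    by right; exists x, q.
  by apply: sep => //; exact: cover.
- by rewrite t2.
- by move=> q qt; rewrite t2; exact: clt_trans (wts q qt) tsz.
- move=> q ql; rewrite wxi; first exact: (wl0 y).
  by rewrite /top_list in_cat; left.
- by rewrite wg; exact: cltW.
- move=> q p qt pt _ _; rewrite wxi //; apply: cle_trans ((wtop y q qt).2 p pt) _.
  by rewrite (nxP (j, t0)).2 /= kjk2.
- rewrite t2 wg cltNge; apply/negP => Gk.
  have gz : wt (tg (Dj j)) m <o z.
    by apply: clt_trans tsz; exact: (wtop y _ g_top).1.
  have := (GP zl gz).1; apply/negP; rewrite -cleNgt.
  exact: cle_trans (amono _ _ Gk) t0g.
(* A label below [z] is below [t0], hence not above the weight at [g]. At [z], the first rung beyond
   that weight exceeds the top's weights by [F3t0]. Above [z], the first such rung is at least [z],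
   which exceeds them. *)
- move=> q p qt pb pl; rewrite wg => gp qp.
  have [Hlt Hgt] := GP pl gp; apply: (GP pl qp).2.
  have [_ pz1 pz2] := botok p pb pl.
  case: (clt_trich (l2 p) z) => [pz|pz|pz].
  + by case: (clt_asym (pz1 pz)); exact: cle_lt_trans t0g gp.
  + apply: clt_trans (wts q qt) _.
    apply: (F3t0 _ _ _).1; first exact: cle_lt_trans t0g Hlt.
    by rewrite pz; exists (G z (wt (tg (Dj j)) m)).
  + case: (cltP (a (l2 p) (G (l2 p) (wt (tg (Dj j)) m))) z) => [/(pz2 pz) lt|ge].
      by case: (clt_asym lt); exact: cle_lt_trans t0g Hlt.
    exact: clt_le_trans (clt_trans (wts q qt) tsz) ge.
- move=> p pb pl; rewrite wg => gp; have [H _ _] := botok p pb pl.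
  by apply: H; exact: clt_trans epsg gp.
Qed.

End Main.

(** * Coloring of pairs and proof of the theorem *)

Lemma ordered_pairE (L : cardinal) (x y x' y' : L) :
  x <o y -> x' <o y' -> [set x; y] = [set x'; y'] -> x = x' /\ y = y'.
Proof.
move=> xy xy' E.
have x_in : [set x'; y'] x by rewrite -E; left.
have y_in : [set x'; y'] y by rewrite -E; right.
case: x_in y_in => /= xE [] /= yE; rewrite xE yE in xy *.
- by case: (clt_irr xy).
- by [].
- by case: (clt_asym xy).
- by case: (clt_irr xy).
Qed.

Lemma embeds_sum (L T U : cardinal) : regular L -> embeds T L -> embeds U L ->
  embeds (L + T + U) L.
Proof.
move=> Lreg [f fi] [g gi]; apply: embeds_trans (regular_square Lreg).
have [a] := regular_point Lreg; have Lno := (regular_breg Lreg).1.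
have [b ab] := Lno a; have [c bc] := Lno b.
have nab := clt_neq ab; have nbc := clt_neq bc; have nac := clt_neq (clt_trans ab bc).
exists (fun s => match s with inl (inl x) => (a, x) | inl (inr t) => (b, f t) | inr u => (c, g u) end).
by move=> [[x|t]|u] [[x'|t']|u'] [] //; do ?[by move=> -> | by move=> /fi -> |
  by move=> /gi -> | by move=> /esym].
Qed.

Theorem theorem2p2 (partial theta theta_succ lambda : cardinal)
  (partial_reg : regular partial) (theta_reg : regular theta)
  (theta_inf : [set: nat] #<= [set: theta])
  (theta_succP : is_succ theta theta_succ)
  (partial_gt : card_lt theta_succ partial)
  (lambdaP : is_succ partial lambda) :
  Pr1_same lambda lambda lambda theta.
Proof.
have tpreg := succ_regular theta_reg theta_succP.
have Lreg := succ_regular partial_reg lambdaP.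
have [/cardT_le_embeds th_tp ntp_th] := theta_succP.1.
have [/cardT_le_embeds tp_P nP_tp] := partial_gt.
have [/cardT_le_embeds P_L nL_P] := lambdaP.1.
have tp_L := embeds_trans tp_P P_L; have th_L := embeds_trans th_tp tp_L.
have [p0] := regular_point partial_reg; have [i0] := regular_point tpreg.
have [k0] := regular_point theta_reg; have [x0] := regular_point Lreg.
have [e e_inj] := succ_enum theta_reg theta_succP.
have [||a a_guess] := club_guessing partial_reg theta_reg tpreg _ _ th_tp.
- by move=> /cardT_le_embeds.
- by move=> /cardT_le_embeds.
(* The index of [v] in the ladder at [z] is that of the first rung above [v]; [k0] is a default. *)
have HG (zv : partial * partial) : exists k, ladder zv.1 (a zv.1) -> zv.2 <o zv.1 ->
    zv.2 <o a zv.1 k /\ forall k', zv.2 <o a zv.1 k' -> k <=o k'.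
  case: zv => z v /=; case: (pselect (exists k, v <o a z k)) => [/ex_least [k kP]|n].
    by exists k.
  by exists k0 => -[_ _ acof] /acof.
have [G GP] := choice HG.
have [h [wt hwtP]] := walk_data partial_reg lambdaP.
have LC : embeds (lambda * theta_succ * partial) lambda.
  apply: embeds_trans (regular_square Lreg).
  have [sq sqi] := regular_square Lreg; have [f fi] := tp_L; have [f' fi'] := P_L.
  exists (fun p => (sq (p.1.1, f p.1.2), f' p.2)) => -[[x i] z] [[x' i'] z'] /= [].
  by move=> /sqi [-> /fi ->] /fi' ->.
have Sstat : stat (@cofK partial lambda).
  by apply: stat_ladder => //; move/cardT_le_embeds.
have [lab labP] := stat_labels (x0, i0, p0) partial_reg lambdaP Sstat LC.
pose col x := (lab x).1.1; pose l1 x := (lab x).1.2; pose l2 x := (lab x).2.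
(* A pair gets the color of a point located on the walk between its members, and [x0] if there is
   none. *)
pose Q (A : pairs lambda) v := exists xi eta l ga, [/\ xi <o eta, sval A = [set xi; eta],
  walk h wt xi eta l, located e a (fun z v => G (z, v)) l1 l2 (fun b => wt b xi) l ga & v = col ga].
have Hc A : exists v, (exists v', Q A v') -> Q A v.
  case: (pselect (exists v', Q A v')) => [[v Qv]|n]; first by exists v.
  by exists x0.
have [c cP] := choice Hc.
split; first exact: card_lexx.
  by apply/cardT_le_embeds; exact: embeds_sum.
exists c => j0 j1 zeta0 zeta1 inj0 inj1 disj gamma.
have [|al0 [al1 [al01 alP]]] := @monochromatic_rectangle partial theta theta_succ lambda
  partial_reg theta_reg theta_succP partial_gt lambdaP e a (fun z v => G (z, v)) h wt col l1 l2
  e_inj a_guess (fun z v => GP (z, v)) hwtP _ _ _ (@below_small theta j0) (@below_small theta j1)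
  zeta0 zeta1 inj0 inj1 gamma.
  move=> g i z; apply: (stat_sub (labP (g, i, z))) => x [xS xl]; split=> //.
  by rewrite /col /l1 /l2 xl.
exists al0, al1; split=> // x y; have [xy [l [ga [W gac loc]]]] := alP x y.
have [|xi [eta [l' [ga' [xe AE W' loc' ->]]]]] := cP (upair (disj al0 x al1 y)).
  exists (col ga), (zeta0 al0 x), (zeta1 al1 y), l, ga; split=> //; exact/loc.
(* Walks are unique, so the walk behind the value of [c] is that of the rectangle, on which only
   [ga] is located. *)
have [xiE etaE] := ordered_pairE xy xe AE; subst xi eta.
by rewrite -gac (walk_uniq W' W) in loc' *; move/loc: loc' => ->.
Qed.
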